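(* Let $\alpha\in(0,1)$ be irrational and consider the Sturmian hull $\Omega_\alpha$. Then, for every $\lambda\in\mathbb R$, the stability set $\Omega_\alpha^s$ has positive measure, i.e. there is a measurable set $\Omega_0\subseteq\Omega_\alpha^s$ with $\mu(\Omega_0)>0$.
   Context: For irrational $\alpha\in(0,1)$ let $v_\alpha:\mathbb Z\to\{0,1\}$, $v_\alpha(n)=\chi_{[1-\alpha,1)}(n\alpha \bmod 1)$. With $T$ the shift $(T\omega)_n=\omega_{n+1}$ on $\{0,1\}^{\mathbb Z}$ (product topology), the Sturmian hull is $$\Omega_\alpha=\{\omega\in\{0,1\}^{\mathbb Z}:\ \omega=\lim_{i\to\infty} T^{n_i}v_\alpha \text{ for some sequence } n_i\to\infty\}.$$ $(\Omega_\alpha,T)$ is strictly ergodic; $\mu$ is its unique invariant Borel probability measure, which on a cylinder set equals the frequency of the corresponding word in $v_\alpha$. For $\lambda\in\mathbb R$ and $\omega\in\Omega_\alpha$ let $V_\omega(n)=\lambda\omega_n$ and let $H_\omega$ be the operator on $\ell^2(\mathbb Z)$ given by $(H_\omega\phi)(n)=\phi(n+1)+\phi(n-1)+V_\omega(n)\phi(n)$. The spectrum $\sigma(H_\omega)$ is the same set $\Sigma$ for all $\omega\in\Omega_\alpha$ (it depends on $\lambda$ and $\alpha$). The stability set $\Omega^s_\alpha$ (for given $\lambda$) is the set of all $\omega\in\Omega_\alpha$ such that for every $E\in\Sigma$ there is $\varepsilon\in\{+,-\}$ such that no nonzero solution $\phi:\mathbb Z\to\mathbb C$ of $\phi(n+1)+\phi(n-1)+V_\omega(n)\phi(n)=E\phi(n)$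 is square-summable at $\varepsilon\infty$ (i.e. $\sum_{n\ge 0}|\phi(\varepsilon n)|^2=\infty$ for every nonzero solution). *)

(* Defs.v *)
From HB Require Import structures.
From mathcomp Require Import all_boot all_order all_algebra.
From mathcomp Require Import complex.
From mathcomp Require Import all_classical all_reals all_analysis.

Set Implicit Arguments.
Unset Strict Implicit.
Unset Printing Implicit Defensive.

Import Order.TTheory GRing.Theory Num.Theory.
Import numFieldNormedType.Exports.

Local Open Scope classical_set_scope.
Local Open Scope ring_scope.

(* The product topology over discrete [bool]; the letters 0 and 1 are [false]
   and [true]. *)
Notation full_shift := {ptws int -> bool}.

Notation borel_full_shift := (g_sigma_algebraType (@open full_shift)).

Definition shift_map (w : full_shift) : full_shift := fun n : int => w (n + 1).

Section SturmianHull.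
Variable R : realType.
Implicit Types alpha : R.

Definition frac_part (x : R) : R := x - (Num.floor x)%:~R.

Definition sturmian_word alpha : full_shift :=
  fun n : int => frac_part (n%:~R * alpha) \in `[1 - alpha, 1[.

Definition sturmian_hull alpha : set full_shift :=
  [set w | exists2 k : nat -> nat, k @ \oo --> \oo &
     (fun i => iter (k i) shift_map (sturmian_word alpha)) @ \oo --> w].

(* An invariant Borel probability measure on the hull is a shift-invariant one
   on the full shift for which the (closed, shift-invariant) hull has full
   measure. *)
Definition invariant_on_hull alpha (mu : probability borel_full_shift R) :=
  (forall A : set borel_full_shift,
     measurable A -> mu (shift_map @^-1` A) = mu A) /\
  mu (sturmian_hull alpha) = 1%E.

End SturmianHull.

Section EllTwo.
Variable R : realType.
Local Notation C := R[i].
Implicit Types (phi psi : int -> C) (A B : (int -> C) -> int -> C).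

Definition abs2 (z : C) : \bar R := (Normc.normc z ^+ 2)%:E.

Definition ell2 : set (int -> C) :=
  [set phi | summable [set: int] (fun n => abs2 (phi n))].

Definition ell2_norm phi : R :=
  Num.sqrt (fine (\esum_(n in [set: int]) abs2 (phi n))).

(* Operators on ell2 are functions on all two-sided sequences of which only the
   values on [ell2] matter. *)
Definition bounded_operator B : Prop :=
  [/\ forall phi, ell2 phi -> ell2 (B phi),
      forall (a : C) phi psi, ell2 phi -> ell2 psi ->
        B (fun n => a * phi n + psi n) = (fun n => a * B phi n + B psi n) &
      exists M : R, forall phi, ell2 phi ->
        ell2_norm (B phi) <= M * ell2_norm phi].

Definition resolvent_set A : set C :=
  [set z | exists2 B, bounded_operator B & forall phi, ell2 phi ->
     B (fun n => A phi n - z * phi n) = phi /\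
     (fun n => A (B phi) n - z * B phi n) = phi].

Definition spectrum A : set C := ~` resolvent_set A.

End EllTwo.

Section Schroedinger.
Variable R : realType.
Local Notation C := R[i].
Implicit Types (alpha lambda : R) (w : full_shift) (phi : int -> C).

Definition potential lambda w (n : int) : R := lambda * (w n)%:R.

Definition schroedinger lambda w phi : int -> C :=
  fun n => phi (n + 1) + phi (n - 1) + (potential lambda w n)%:C%C * phi n.

Definition is_solution lambda w (E : C) phi : Prop :=
  forall n, schroedinger lambda w phi n = E * phi n.

(* [s = false] stands for the half-line towards +oo, [s = true] for -oo. *)
Definition no_ell2_solution_at (s : bool) lambda w (E : C) : Prop :=
  forall phi, is_solution lambda w E phi -> (exists n, phi n != 0) ->
    (\sum_(0 <= n <oo) abs2 (phi ((-1) ^+ s * n%:Z)%R) = +oo)%E.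

(* The common spectrum of the operators over the hull is taken to be the
   spectrum of the operator attached to [w] itself. *)
Definition stability_set alpha lambda : set full_shift :=
  [set w | sturmian_hull alpha w /\
     forall E : C, spectrum (schroedinger lambda w) E ->
       exists s : bool, no_ell2_solution_at s lambda w E].

End Schroedinger.

(* Main.v *)
(* Running the additive Euclidean algorithm on (alpha, 1 - alpha) yields pairs of
   words (u, v) coding the two branches of the first return map of the rotation to
   shrinking intervals; each step keeps one word and replaces the other one by its
   concatenation with the kept word. The traces of the transfer matrices of u, v
   and uv evolve by the trace map (x, y, z) -> (x, z, xz - y). If |x|, |y| > 2 and
   |z| > max(|x|, |y|) at some step, this persists, and it persists for energies
   near E; hence long periodic approximants of the operator have no spectrum near
   E. As the operator has finite range, the bound they give carries over to the
   operator itself, and E lies in the resolvent set. So for E in the spectrum no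
   triple escapes, and the Fricke invariant bounds the trace of every kept word
   by 6 + |lambda|.

   On the other hand, infinitely often the kept word w is at most twice as long as
   the other one, and then every element of the hull has, at one of seven
   equidistant positions, a square ss with s a cyclic conjugate of w. By
   invariance of mu the set of elements beginning with such a square has measure
   at least 1/7, and so does the limit superior of these sets. For an element of
   the latter, the Cayley-Hamilton theorem over the squares and the bound on the
   traces exclude solutions that are square-summable at +oo, for all E in the
   spectrum simultaneously. *)

From HB Require Import structures.
Require Import Defs.
From mathcomp Require Import all_boot all_order all_algebra.
From mathcomp Require Import complex.
From mathcomp Require Import all_classical all_reals all_analysis.
From mathcomp Require Import zify ring lra.

Set Implicit Arguments.
Unset Strict Implicit.
Unset Printing Implicit Defensive.

Import Order.TTheory GRing.Theory Num.Theory.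
Import numFieldNormedType.Exports.

Local Open Scope classical_set_scope.
Local Open Scope ring_scope.

(** * Rotations and the Euclidean algorithm *)

Section Rotation.
Variables (R : realType) (alpha : R).
Hypothesis halpha : 0 < alpha < 1.
Implicit Types (a b y : R) (u v w o : seq bool).

(* [y] stands for the point [y + 1 - alpha] of the circle, which puts the
   discontinuity of the coding at 0. *)
Definition rotation (y : R) : R :=
  if y < 0 then y + alpha else y - (1 - alpha).

Definition letter (y : R) : bool := 0 <= y.

Fixpoint coding (y : R) (n : nat) : seq bool :=
  if n is n'.+1 then letter y :: coding (rotation y) n' else [::].

Local Notation f := rotation.

Lemma size_coding y n : size (coding y n) = n.
Proof. by elim: n y => //= n IH y; rewrite IH. Qed.

Lemma coding_cat y m n :
  coding y (m + n) = coding y m ++ coding (iter m f y) n.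
Proof.
by elim: m y => //= m IH y; rewrite IH -iterS iterSr.
Qed.

Lemma nth_coding y n i : (i < n)%N ->
  nth false (coding y n) i = letter (iter i f y).
Proof.
by elim: n y i => //= n IH y [|i]//= lt_in; rewrite IH// -iterS iterSr.
Qed.

Lemma rotation_itv (y : R) : alpha - 1 <= y < alpha -> alpha - 1 <= f y < alpha.
Proof.
have h1 := halpha; rewrite /rotation => yI; by case: ltP => h; lra.
Qed.

Lemma iter_rotation_itv n (y : R) :
  alpha - 1 <= y < alpha -> alpha - 1 <= iter n f y < alpha.
Proof. by move=> yI; elim: n => //= n; exact: rotation_itv. Qed.

Lemma iter_rotationE n y :
  exists m : int, iter n f y = y + n%:R * alpha - m%:~R.
Proof.
elim: n => [|n [m IH]]; first by exists 0 => /=; ring.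
rewrite iterS {1}/rotation IH; case: ifP => _.
  by exists m; rewrite -natr1; ring.
by exists (m + 1); rewrite -natr1 intrD; ring.
Qed.

(* The first return map of the rotation to [-b, a) exchanges [-b, 0) and [0, a):
   it adds [a] on the first one, where the coding reads [u], and subtracts [b]
   on the second one, where the coding reads [v]. *)
Record exchange (u v : seq bool) (a b : R) : Prop := Exchange {
  exchange_a : 0 < a <= alpha;
  exchange_b : 0 < b <= 1 - alpha;
  exchange_size_u : (0 < size u)%N;
  exchange_size_v : (0 < size v)%N;
  exchange_u : forall y, - b <= y < 0 ->
    coding y (size u) = u /\ iter (size u) f y = y + a;
  exchange_v : forall y, 0 <= y < a ->
    coding y (size v) = v /\ iter (size v) f y = y - b;
  exchange_return_u : forall y j, - b <= y < 0 -> (0 < j < size u)%N ->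
    ~ (- b <= iter j f y < a);
  exchange_return_v : forall y j, 0 <= y < a -> (0 < j < size v)%N ->
    ~ (- b <= iter j f y < a);
  exchange_enter : forall y, alpha - 1 <= y < alpha ->
    exists j, - b <= iter j f y < a;
  exchange_int_a : exists m : int, a = (size u)%:R * alpha - m%:~R;
  exchange_int_b : exists m : int, b = m%:~R - (size v)%:R * alpha }.

Lemma exchange_start : exchange [:: false] [:: true] alpha (1 - alpha).
Proof.
have h1 := halpha; split => //=; try lra.
- move=> y /andP[_ y0]; rewrite /letter /rotation y0; split => //.
  by rewrite leNgt y0.
- move=> y /andP[y0 _]; rewrite /letter /rotation y0; split => //.
  by rewrite ltNge y0.
- by move=> y j _; case: j => [|[]].
- by move=> y j _; case: j => [|[]].
- by move=> y yI; exists 0%N => /=; lra.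
- by exists 0; ring.
- by exists 1; ring.
Qed.

(** Induction on the shorter interval [[a - b, a)]: the word [v] sends a point of [[0, a)] into
    [[-b, a - b)], the part just cut off, and [u] brings it back. *)
Lemma exchange_keep_u u v a b : exchange u v a b -> a < b ->
  exchange u (v ++ u) a (b - a).
Proof.
move=> [ia ib su sv iu iv ru rv en [ma ea] [mb eb]] ab.
split => //; try lra.
- by rewrite size_cat addn_gt0 sv.
- by move=> y yI; apply: iu; lra.
- move=> y yI; have [cv fv] := iv _ yI.
  have [cu fu] : coding (y - b) (size u) = u /\
    iter (size u) f (y - b) = y - b + a by apply: iu; lra.
  rewrite size_cat coding_cat cv fv cu; split => //.
  by rewrite addnC iterD fv fu; ring.
- move=> y j yI jI rI; apply: (@ru y j) => //; lra.
- move=> y j yI; rewrite size_cat => jI rI.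
  have [cv fv] := iv _ yI.
  case: (ltngtP j (size v)) => [jv|jv|jv].
  + by apply: (@rv y j) => //; [rewrite jv; case/andP: jI => ->|lra].
  + have ej : j = (j - size v + size v)%N by rewrite subnK// ltnW.
    move: rI; rewrite ej iterD fv => rI.
    by apply: (@ru (y - b) (j - size v)%N) => //; [lra|by move: jI jv; clear; lia|by move: rI ia ib; clear -ab; lra].
  + by move: rI; rewrite jv fv; lra.
- move=> y /en [j jI]; have [h|h] := leP (a - b) (iter j f y).
    by exists j; lra.
  have [] := iu (iter j f y); first by lra.
  by rewrite -iterD => _ e; exists (size u + j)%N; rewrite e; lra.
- by exists ma.
- by exists (mb + ma); rewrite size_cat natrD eb ea intrD; ring.
Qed.

(** Mirror image: now [[a - b, a)] is cut off, and a point of [[-b, 0)] sent there by [u] is brought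
    back by [v]. *)
Lemma exchange_keep_v u v a b : exchange u v a b -> b < a ->
  exchange (u ++ v) v (a - b) b.
Proof.
move=> [ia ib su sv iu iv ru rv en [ma ea] [mb eb]] ab.
split => //; try lra.
- by rewrite size_cat addn_gt0 su.
- move=> y yI; have [cu fu] := iu _ yI.
  have [cv fv] : coding (y + a) (size v) = v /\
    iter (size v) f (y + a) = y + a - b by apply: iv; lra.
  rewrite size_cat coding_cat cu fu cv; split => //.
  by rewrite addnC iterD fu fv; ring.
- by move=> y yI; apply: iv; lra.
- move=> y j yI; rewrite size_cat => jI rI.
  have [cu fu] := iu _ yI.
  case: (ltngtP j (size u)) => [jv|jv|jv].
  + by apply: (@ru y j) => //; [rewrite jv; case/andP: jI => ->|lra].
  + have ej : j = (j - size u + size u)%N by rewrite subnK// ltnW.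
    move: rI; rewrite ej iterD fu => rI.
    by apply: (@rv (y + a) (j - size u)%N) => //; [lra|by move: jI jv; clear; lia|by move: rI ia ib; clear -ab; lra].
  + by move: rI; rewrite jv fu; lra.
- move=> y j yI jI rI; apply: (@rv y j) => //; lra.
- move=> y /en [j jI]; have [h|h] := ltP (iter j f y) (a - b).
    by exists j; lra.
  have [] := iv (iter j f y); first by lra.
  by rewrite -iterD => _ e; exists (size v + j)%N; rewrite e; lra.
- by exists (mb + ma); rewrite size_cat natrD eb ea intrD; ring.
- by exists mb.
Qed.

(* [marker] is visited exactly where a block [w] is followed by a block [o] of
   the other kind; away from it the coding is [size w]-periodic. *)
Record marked (w o : seq bool) (marker : set R) : Prop := Marked {
  marked_size : (0 < size w)%N;
  marked_coding : forall y, marker y -> coding y (size w) = w;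
  marked_return : forall y j, marker y -> (0 < j < size w + size o)%N ->
    ~ marker (iter j f y);
  marked_enter : forall y, alpha - 1 <= y < alpha ->
    exists j, marker (iter j f y);
  marked_period : forall y, alpha - 1 <= y < alpha ->
    ~ marker y -> ~ marker (f y) ->
    letter (iter (size w) f (f y)) = letter (f y) }.

Lemma int_itv01 (k : int) : -1 < k%:~R :> R -> k%:~R < 2 :> R -> k = 0 \/ k = 1.
Proof. by rewrite -[X in X < _](mulrN1z 1) -[2]/(2%:~R) !ltr_int; lia. Qed.

(** After [u] a point of [[-a, 0)] lies in [[0, a)], where [v] is read. As for the period, [size u]
    steps translate by [a] modulo 1, and the letter changes only if this crosses 0 or the image of 0
    under the rotation, which is the end of the interval. In the first case [f y] lies in the
    marker, in the second [y] does. *)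
Lemma marked_keep_u u v a b : exchange u v a b -> a < b ->
  marked u v [set y | - a <= y < 0].
Proof.
move=> [ia ib su sv iu iv ru rv en [ma ea] [mb eb]] ab.
split => //=.
- by move=> y yI; apply: (iu _ _).1; lra.
- move=> y j yI jI rI; have [|_ fu] := iu y _; first by lra.
  have [|_ fv] := iv (y + a) _; first by lra.
  case: (ltngtP j (size u)) => [jv|jv|jv].
  + by apply: (@ru y j) => //; [lra|rewrite jv; case/andP: jI => ->|lra].
  + have ej : j = (j - size u + size u)%N by rewrite subnK// ltnW.
    move: rI; rewrite ej iterD fu => rI.
    by apply: (@rv (y + a) (j - size u)%N) => //; [lra|by move: jI jv; clear; lia|by move: rI ia ib; clear -ab; lra].
  + by move: rI; rewrite jv fu; lra.
- move=> y /en[j jI].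
  have [i iI] : exists i, - b <= iter i f y < 0.
    have [h|h] := ltP (iter j f y) 0; first by exists j; lra.
    have [|_ fv] := iv (iter j f y) _; first by lra.
    by exists (size v + j)%N; rewrite iterD fv; lra.
  (* As long as the point is below [-a], another [u] adds [a] and keeps it negative; [k] bounds the
     number of repetitions. *)
  have [k] : exists k, - iter i f y <= k%:R * a.
    exists (Num.bound (- iter i f y / a)).
    rewrite -ler_pdivrMr; last by lra.
    by apply/ltW/archi_boundP; apply: divr_ge0; lra.
  elim: k {jI} i iI => [|k IH] i iI hk; first by lra.
  have [h|h] := leP (- a) (iter i f y); first by exists i; lra.
  have [|_ fu] := iu (iter i f y) _; first by lra.
  apply: (IH (size u + i)%N); rewrite iterD fu; first by lra.
  by move: hk; rewrite -natr1 mulrDl; lra.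
- move=> y yI nm nfm.
  have [m em] := iter_rotationE (size u) (f y).
  have := iter_rotation_itv (size u) (rotation_itv yI).
  have fI := rotation_itv yI.
  have e : iter (size u) f (f y) = f y + a - (m - ma)%:~R.
    by rewrite em ea intrB; ring.
  rewrite e => eI.
  have [mk|mk] : m - ma = 0 \/ m - ma = 1 by apply: int_itv01; lra.
  + rewrite mk /letter; apply/idP/idP => h; last by lra.
    by rewrite leNgt; apply/negP => h'; apply: nfm; lra.
  + rewrite mk /letter.
    by exfalso; move: eI fI; rewrite mk /rotation; case: ltP => h h1 h2; [apply: nm|]; lra.
Qed.

Lemma marked_keep_v u v a b : exchange u v a b -> b < a ->
  marked v u [set y | 0 <= y < b].
Proof.
move=> [ia ib su sv iu iv ru rv en [ma ea] [mb eb]] ab.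
split => //=.
- by move=> y yI; apply: (iv _ _).1; lra.
- move=> y j yI jI rI; have [|_ fv] := iv y _; first by lra.
  have [|_ fu] := iu (y - b) _; first by lra.
  case: (ltngtP j (size v)) => [jv|jv|jv].
  + by apply: (@rv y j) => //; [lra|rewrite jv; case/andP: jI => ->|lra].
  + have ej : j = (j - size v + size v)%N by rewrite subnK// ltnW.
    move: rI; rewrite ej iterD fv => rI.
    by apply: (@ru (y - b) (j - size v)%N) => //; [lra|by move: jI jv; clear; lia|by move: rI ia ib; clear -ab; lra].
  + by move: rI; rewrite jv fv; lra.
- move=> y /en[j jI].
  have [i iI] : exists i, 0 <= iter i f y < a.
    have [h|h] := leP 0 (iter j f y); first by exists j; lra.
    have [|_ fu] := iu (iter j f y) _; first by lra.
    by exists (size u + j)%N; rewrite iterD fu; lra.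
  have [k] : exists k, iter i f y <= k%:R * b.
    exists (Num.bound (iter i f y / b)).
    rewrite -ler_pdivrMr; last by lra.
    by apply/ltW/archi_boundP; apply: divr_ge0; lra.
  elim: k {jI} i iI => [|k IH] i iI hk; first by exists i; lra.
  have [h|h] := ltP (iter i f y) b; first by exists i; lra.
  have [|_ fv] := iv (iter i f y) _; first by lra.
  apply: (IH (size v + i)%N); rewrite iterD fv; first by lra.
  by move: hk; rewrite -natr1 mulrDl; lra.
- move=> y yI nm nfm.
  have [m em] := iter_rotationE (size v) (f y).
  have := iter_rotation_itv (size v) (rotation_itv yI).
  have fI := rotation_itv yI.
  have e : iter (size v) f (f y) = f y - b + (mb - m)%:~R.
    by rewrite em eb intrB; ring.
  rewrite e => eI.
  have [mk|mk] : mb - m = 0 \/ mb - m = 1 by apply: int_itv01; lra.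
  + rewrite mk /letter; apply/idP/idP => h; first by lra.
    by rewrite leNgt; apply/negP => h'; apply: nfm; lra.
  + rewrite mk /letter.
    exfalso; move: eI fI; rewrite mk /rotation.
    by case: ltP => h h1 h2; [|apply: nm]; lra.
Qed.

End Rotation.

(** * The words produced by the Euclidean algorithm: lengths, positions free of markers, link to the
    Sturmian word *)

Section Euclid.
Variables (R : realType) (alpha : R).
Implicit Types (a b y : R) (u v w o : seq bool).
Local Notation f := (rotation alpha).
Local Notation coding := (coding alpha).
Local Notation marked := (marked alpha).

Lemma rot1_coding y p : (0 < p)%N ->
  letter (iter p f y) = letter y -> coding (f y) p = rot 1 (coding y p).
Proof.
case: p => // p _ e; rewrite -(addn1 p) coding_cat addn1 [coding y _]/= rot1_cons.
by rewrite -cats1 /= -iterSr e.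
Qed.

(* Consecutive visits to the marker are at least [size w + size o] apart, so the
   [size w + 1] bad positions up to a visit are followed by [size o - 1] good ones,
   among which every progression of step [size o - 1] has a term. *)
Lemma marked_cover w o m y : marked w o m -> (size w <= 2 * size o)%N ->
  (1 < size o)%N -> exists2 i, (i < 7)%N & forall n,
  (i * (size o).-1 <= n <= i * (size o).-1 + size w)%N -> ~ m (iter n f y).
Proof.
move=> mw; set p := size w; set q := size o => pq q1.
have gap n n' : m (iter n f y) -> m (iter n' f y) -> (n < n')%N ->
    (n + p + q <= n')%N.
  move=> mn mn' nn'; rewrite leqNgt; apply/negP => lt.
  apply: (marked_return mw (j := (n' - n)%N) mn); last first.
    by rewrite -iterD subnK// ltnW.
  by rewrite -/p -/q; lia.
have [all0|] := pselect (forall n, (0 <= n <= p)%N -> ~ m (iter n f y)).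
  by exists 0%N => // n; rewrite mul0n; exact: all0.
move=> /existsNP[n /not_implyP[n_p /contrapT mn]].
have t0 : (0 < q.-1)%N by lia.
have e1 := divn_eq n q.-1; have e2 := ltn_pmod n t0.
set t := q.-1 in e1 e2 t0 *.
(* The first multiple of [t] after the visit [n] is at most [n + t], so the window starting there
   ends before [n + p + q], the earliest next visit. As [n <= p <= 2 * q = 2 * t + 2 <= 4 * t], the
   index stays below 7. *)
exists (n %/ t).+1.
  by rewrite ltnS -(leq_pmul2r t0); lia.
move=> n' n'I mn'.
have := gap _ _ mn mn'; rewrite /t in n'I e1 e2 t0.
by nia.
Qed.

Definition euclid_step (s : (seq bool * seq bool) * (R * R)) :=
  let: ((u, v), (a, b)) := s in
  if a < b then ((u, v ++ u), (a, b - a)) else ((u ++ v, v), (a - b, b)).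

Definition euclid n := iter n euclid_step
  (([:: false], [:: true]), (alpha, 1 - alpha)).

Definition eu n := (euclid n).1.1.
Definition ev n := (euclid n).1.2.
Definition ea n := (euclid n).2.1.
Definition eb n := (euclid n).2.2.
Definition keep_u n : bool := ea n < eb n.
Definition kept n := if keep_u n then eu n else ev n.
Definition other n := if keep_u n then ev n else eu n.

Lemma euS n : eu n.+1 = if keep_u n then eu n else eu n ++ ev n.
Proof.
rewrite /keep_u /eu /ev /ea /eb /euclid iterS /euclid_step.
by case: (iter n _ _) => -[u v] [a b] /=; case: ifP.
Qed.

Lemma evS n : ev n.+1 = if keep_u n then ev n ++ eu n else ev n.
Proof.
rewrite /keep_u /eu /ev /ea /eb /euclid iterS /euclid_step.
by case: (iter n _ _) => -[u v] [a b] /=; case: ifP.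
Qed.

Lemma eaS n : ea n.+1 = if keep_u n then ea n else ea n - eb n.
Proof.
rewrite /keep_u /eu /ev /ea /eb /euclid iterS /euclid_step.
by case: (iter n _ _) => -[u v] [a b] /=; case: ifP.
Qed.

Lemma ebS n : eb n.+1 = if keep_u n then eb n - ea n else eb n.
Proof.
rewrite /keep_u /eu /ev /ea /eb /euclid iterS /euclid_step.
by case: (iter n _ _) => -[u v] [a b] /=; case: ifP.
Qed.

Lemma size_eu_homo m n : (m <= n)%N -> (size (eu m) <= size (eu n))%N.
Proof.
apply: (homo_leq (f := fun n => size (eu n)) leqnn (@leq_trans)) => {m n} k; rewrite euS; case: ifP => //.
by rewrite size_cat leq_addr.
Qed.

Lemma size_ev_homo m n : (m <= n)%N -> (size (ev m) <= size (ev n))%N.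
Proof.
apply: (homo_leq (f := fun n => size (ev n)) leqnn (@leq_trans)) => {m n} k; rewrite evS; case: ifP => //.
by rewrite size_cat leq_addr.
Qed.

(** Let [k] be kept and [o] replaced at step [N]. If the same word is kept at two successive steps,
    the other one contains it at the second. If the choice changes at [N.+1] and again at [N.+2],
    the lengths at [N.+2] are [|o| + 2|k|] and [|o| + |k|]. *)
Lemma size_kept_le_other N : exists2 n, (N <= n)%N &
  (size (kept n) <= 2 * size (other n))%N.
Proof.
have [h1|h1] := leqP (size (kept N.+1)) (2 * size (other N.+1)).
  by exists N.+1.
have [h2|h2] := leqP (size (kept N.+2)) (2 * size (other N.+2)).
  by exists N.+2 => //; lia.
exfalso; move: h1 h2; rewrite /kept /other.
case k0 : (keep_u N); case k1 : (keep_u N.+1); case k2 : (keep_u N.+2);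
  rewrite ?(euS N.+1) ?(evS N.+1) ?k1 ?(euS N) ?(evS N) ?k0 !size_cat; lia.
Qed.

(** Equality would make [(size u + size v) * alpha] an integer. *)
Lemma exchange_neq u v a b : irrational alpha ->
  exchange alpha u v a b -> a != b.
Proof.
move=> hirr ind; have [m ea] := exchange_int_a ind.
have [k eb] := exchange_int_b ind; apply/eqP => ab.
have su := exchange_size_u ind.
apply: hirr; apply/rationalP; exists (m + k), (size u + size v)%N.
have : (size u + size v)%:R != 0 :> R by rewrite pnatr_eq0; lia.
move=> s0; apply: (mulIf s0); rewrite divfK//.
by rewrite intrD natrD; lra.
Qed.

Hypothesis halpha : 0 < alpha < 1.

(** Until the orbit meets the marker, the window of length [size w] is rotated by one letter at each
    step; at the marker it reads [w] itself. Hence the induction on the time of entrance. *)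
Lemma marked_conjugate w o m y : marked w o m ->
  alpha - 1 <= y < alpha -> ~ m y ->
  exists k, iter k (rot 1) (coding (f y) (size w)) = w.
Proof.
move=> mw yI; have [d] := marked_enter mw yI.
elim: d y yI => [//|d IH] y yI; rewrite iterSr => md nm.
have [mf|nmf] := pselect (m (f y)).
  by exists 0%N; rewrite /= (marked_coding mw).
have [k ek] := IH _ (rotation_itv halpha yI) md nmf.
exists k.+1; rewrite iterSr -rot1_coding//; first exact: marked_size mw.
exact: (marked_period mw).
Qed.

Hypothesis hirr : irrational alpha.

Lemma euclid_exchange n : exchange alpha (eu n) (ev n) (ea n) (eb n).
Proof.
elim: n => [|n IH]; first exact: exchange_start.
rewrite euS evS eaS ebS; case: ifPn => h; first exact: exchange_keep_u.
apply: exchange_keep_v => //.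
by rewrite lt_neqAle eq_sym (exchange_neq hirr IH) leNgt.
Qed.

Lemma kept_marked n : exists m, marked (kept n) (other n) m.
Proof.
have ind := euclid_exchange n; rewrite /kept /other; case: ifPn => h.
  by eexists; apply: (marked_keep_u halpha ind h).
eexists; apply: (marked_keep_v halpha ind).
by rewrite lt_neqAle eq_sym (exchange_neq hirr ind) leNgt.
Qed.

(** Otherwise [eb] would be constant and positive from [N] on, and subtracting it again and again
    would make [ea] negative. *)
Lemma keep_u_infinite N : exists2 n, (N <= n)%N & keep_u n.
Proof.
apply: contrapT => /forall2NP h.
have h' k : ~~ keep_u (N + k).
  by apply/negP; have [/negP|//] := h (N + k)%N; rewrite leq_addr.
have eb_c k : eb (N + k) = eb N.
  by elim: k => [|k IH]; rewrite ?addn0// addnS ebS (negbTE (h' k)).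
have ea_c k : ea (N + k) = ea N - k%:R * eb N.
  elim: k => [|k IH]; first by rewrite addn0; ring.
  by rewrite addnS eaS (negbTE (h' k)) IH eb_c -natr1; ring.
have /andP[b0 _] := exchange_b (euclid_exchange N).
have := archi_boundP (_ : 0 <= ea N / eb N); set k := Num.bound _ => hk.
have /andP[a0 _] := exchange_a (euclid_exchange N).
have {hk} : ea N / eb N < k%:R by apply: hk; apply: divr_ge0; lra.
rewrite ltr_pdivrMr// => hk.
have /andP[+ _] := exchange_a (euclid_exchange (N + k)).
by rewrite ea_c; lra.
Qed.

Lemma keep_v_infinite N : exists2 n, (N <= n)%N & ~~ keep_u n.
Proof.
apply: contrapT => /forall2NP h.
have h' k : keep_u (N + k).
  by have [/negP|/negP] := h (N + k)%N; rewrite ?leq_addr// negbK.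
have ea_c k : ea (N + k) = ea N.
  by elim: k => [|k IH]; rewrite ?addn0// addnS eaS (h' k).
have eb_c k : eb (N + k) = eb N - k%:R * ea N.
  elim: k => [|k IH]; first by rewrite addn0; ring.
  by rewrite addnS ebS (h' k) IH ea_c -natr1; ring.
have /andP[a0 _] := exchange_a (euclid_exchange N).
have := archi_boundP (_ : 0 <= eb N / ea N); set k := Num.bound _ => hk.
have /andP[b0 _] := exchange_b (euclid_exchange N).
have {hk} : eb N / ea N < k%:R by apply: hk; apply: divr_ge0; lra.
rewrite ltr_pdivrMr// => hk.
have /andP[+ _] := exchange_b (euclid_exchange (N + k)).
by rewrite eb_c; lra.
Qed.

Lemma size_euclid_infty K : exists N, forall n, (N <= n)%N ->
  (K <= size (eu n))%N /\ (K <= size (ev n))%N.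
Proof.
elim: K => [|K [N IH]]; first by exists 0%N.
have [n1 N1 h1] := keep_u_infinite N; have [n2 N2 h2] := keep_v_infinite N.
exists (maxn n1 n2).+1 => n; rewrite gtn_max => /andP[n1n n2n]; split.
  apply: leq_trans (size_eu_homo n2n).
  rewrite euS (negbTE h2) size_cat -addn1 leq_add// ?(IH n2 N2).1//.
  exact: exchange_size_v (euclid_exchange n2).
apply: leq_trans (size_ev_homo n1n).
rewrite evS h1 size_cat -addn1 leq_add// ?(IH n1 N1).2//.
exact: exchange_size_u (euclid_exchange n1).
Qed.

Lemma size_kept_infty K : exists N, forall n, (N <= n)%N ->
  (K <= size (kept n))%N /\ (K <= size (other n))%N.
Proof.
have [N h] := size_euclid_infty K; exists N => n /h[h1 h2].
by rewrite /kept /other; case: ifP.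
Qed.

(** The point 0 of the circle is [alpha - 1 = f 0] in the present coordinate, so the Sturmian word
    codes the orbit of [f 0] and not that of [0]. *)
Lemma sturmian_wordE n : sturmian_word alpha n%:Z = letter (iter n f (f 0)).
Proof.
have f0 : f 0 = alpha - 1 by rewrite /rotation ltxx; ring.
have h := halpha.
have [m em] := iter_rotationE alpha n (f 0).
have : alpha - 1 <= iter n f (f 0) < alpha.
  by apply: iter_rotation_itv => //; lra.
rewrite em f0 => I; rewrite /sturmian_word /frac_part /letter.
have -> : Num.floor (n%:~R * alpha) = m.
  by apply: floor_def; rewrite intrD; lra.
by rewrite in_itv /=; apply/idP/idP => ?; lra.
Qed.

End Euclid.

Notation normc := Normc.normc.

(** * The trace map *)

Section Normc.
Variable R : realType.
Implicit Types x y z : R[i].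

Lemma normc_ge0 x : 0 <= normc x.
Proof. by case: x => a b; exact: sqrtr_ge0. Qed.

Lemma le_normcB x y : normc x - normc y <= normc (x - y).
Proof.
rewrite lerBlDr; have := @le_normcD R (x - y) y.
by rewrite subrK.
Qed.

Lemma ler_normcB x y : normc (x - y) <= normc x + normc y.
Proof. by rewrite -(@normcN R y); exact: (@le_normcD R x (- y)). Qed.

End Normc.

(** * Cayley-Hamilton for 2 by 2 matrices of determinant 1 *)

Section Mx2.
Variable F : comNzRingType.
Implicit Types A B : 'M[F]_2.

Lemma mx2P A B : A 0 0 = B 0 0 -> A 0 1 = B 0 1 -> A 1 0 = B 1 0 ->
  A 1 1 = B 1 1 -> A = B.
Proof.
move=> h1 h2 h3 h4; apply/matrixP => i j.
have ord2 (k : 'I_2) : k = 0 \/ k = 1.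
  by case: k => -[|[|[]]] lt //; [left|right]; apply: val_inj.
by case: (ord2 i) => ->; case: (ord2 j) => ->.
Qed.

Lemma mulmx2E n (A : 'M[F]_2) (B : 'M[F]_(2, n)) i j :
  (A *m B) i j = A i 0 * B 0 j + A i 1 * B 1 j.
Proof.
by rewrite mxE !big_ord_recl big_ord0 addr0; congr (_ + A i _ * B _ j); apply: val_inj.
Qed.

Lemma mxtrace2E A : \tr A = A 0 0 + A 1 1.
Proof.
by rewrite /mxtrace !big_ord_recl big_ord0 addr0; congr (_ + A _ _); apply: val_inj.
Qed.

Lemma det_mx22 A : \det A = A 0 0 * A 1 1 - A 0 1 * A 1 0.
Proof.
rewrite (expand_det_row _ 0) !big_ord_recl big_ord0 addr0 /cofactor !det_mx11.
rewrite !mxE /= expr0 mul1r expr1 mulN1r mulrN.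
by congr (A _ _ * A _ _ - A _ _ * A _ _); apply: val_inj.
Qed.

Lemma mulmx2_det1 A : \det A = 1 -> A *m A = \tr A *: A - 1%:M.
Proof.
rewrite det_mx22 mxtrace2E => /eqP; rewrite subr_eq => /eqP d.
by apply: mx2P; rewrite mulmx2E !mxE /=; ring: d.
Qed.

Lemma mxtrace_mulmx2 A B : \det A = 1 ->
  \tr (A *m A *m B) = \tr A * \tr (A *m B) - \tr B.
Proof.
move=> /mulmx2_det1 ->.
by rewrite mulmxBl -scalemxAl mul1mx raddfB /= mxtraceZ.
Qed.

End Mx2.

(** * Transfer matrices, escaping traces and the Fricke invariant *)

Section Trace.
Variables (R : realType) (lambda : R).
Local Notation C := R[i].
Implicit Types (E : C) (u v w : seq bool).

Definition transfer1 E (b : bool) : 'M[C]_2 :=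
  \matrix_(i, j) if i == 0 then (if j == 0 then E - (lambda * b%:R)%:C%C else -1)
                 else (if j == 0 then 1 else 0).

(** Matrices act on columns from the left and the first letter acts first, so concatenation reverses
    the order of the factors. *)
Fixpoint transfer E w : 'M[C]_2 :=
  if w is b :: w' then transfer E w' *m transfer1 E b else 1%:M.

Definition trace E w : C := \tr (transfer E w).

Lemma transfer_cat E u v : transfer E (u ++ v) = transfer E v *m transfer E u.
Proof. by elim: u => [|b u IH] /=; rewrite ?mulmx1// IH mulmxA. Qed.

Lemma det_transfer E w : \det (transfer E w) = 1.
Proof.
elim: w => [|b w IH] /=; first by rewrite det1.
by rewrite det_mulmx IH det_mx22 !mxE /=; ring.
Qed.

Lemma trace_catC E u v : trace E (u ++ v) = trace E (v ++ u).
Proof. by rewrite /trace !transfer_cat mxtrace_mulC. Qed.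

Lemma trace_rot E k w : trace E (iter k (rot 1) w) = trace E w.
Proof.
by elim: k => //= k IH; rewrite -IH /rot trace_catC cat_take_drop.
Qed.

Lemma trace_uvu E u v :
  trace E (u ++ (v ++ u)) = trace E u * trace E (u ++ v) - trace E v.
Proof.
rewrite /trace !transfer_cat -mulmxA mxtrace_mulC -mulmxA mxtrace_mulC.
by rewrite mxtrace_mulmx2 ?det_transfer// [in RHS]mxtrace_mulC.
Qed.

Lemma trace_uvv E u v :
  trace E ((u ++ v) ++ v) = trace E v * trace E (u ++ v) - trace E u.
Proof. by rewrite /trace !transfer_cat mulmxA mxtrace_mulmx2 ?det_transfer. Qed.

(* Once this holds for the traces of [u], [v] and [u ++ v], it holds along all
   further steps of the Euclidean algorithm. *)
Definition escaping (x y z : C) : Prop :=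
  [/\ 2 < normc x, 2 < normc y, normc x < normc z & normc y < normc z].

(** Both inequalities for the new coordinate follow from [|xz - y| >= |x||z| - |y|]. *)
Lemma escaping_next x y z : 2 < normc x ->  2 < normc z ->
  normc y <= 2 \/ normc y < normc z -> escaping x z (x * z - y).
Proof.
move=> x2 z2 hy; have := le_normcB (x * z) y; rewrite Normc.normcM => h.
by split => //; case: hy => hy; nra.
Qed.

(** This dichotomy holds at every step of the algorithm: once the traces of both words exceed 2 in
    modulus, that of their concatenation is already larger than either. *)
Definition escaping_or_small (x y z : C) : Prop :=
  [\/ normc x <= 2, normc y <= 2 | escaping x y z].

Lemma escaping_or_small_next x y z :
  escaping_or_small x y z -> escaping_or_small x z (x * z - y).
Proof.
move=> h; have [x2|x2] := leP (normc x) 2; first exact: Or31.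
have [z2|z2] := leP (normc z) 2; first exact: Or32.
apply: Or33; apply: escaping_next => //.
by case: h => [|->|[_ _ _ ->]]; [lra|left|right].
Qed.

Lemma escapingC x y z : escaping x y z <-> escaping y x z.
Proof. by split => -[]. Qed.

Lemma escaping_or_smallC x y z : escaping_or_small x y z -> escaping_or_small y x z.
Proof. by case=> h; [apply: Or32|apply: Or31|apply: Or33; apply/escapingC]. Qed.

Variable alpha : R.
Local Notation eu := (eu alpha).
Local Notation ev := (ev alpha).

Definition escaping_at E n :=
  escaping (trace E (eu n)) (trace E (ev n)) (trace E (eu n ++ ev n)).

Lemma trace_seq1 E b : trace E [:: b] = E - (lambda * b%:R)%:C%C.
Proof. by rewrite /trace /= mul1mx mxtrace2E !mxE /= addr0. Qed.

Lemma trace_start E : trace E [:: false; true] = E * (E - lambda%:C%C) - 2.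
Proof.
rewrite /trace /= mul1mx mxtrace2E !mulmx2E !mxE /= mulr0 mulr1 subr0.
by rewrite mulrC; ring.
Qed.

Lemma escaping_or_small_at E n :
  escaping_or_small (trace E (eu n)) (trace E (ev n)) (trace E (eu n ++ ev n)).
Proof.
elim: n => [|n IH].
  rewrite -[eu 0]/[:: false] -[ev 0]/[:: true] /= trace_start !trace_seq1 mulr0 mulr1 subr0.
  have [x2|x2] := leP (normc E) 2; first exact: Or31.
  have [z2|z2] := leP (normc (E - lambda%:C%C)) 2; first exact: Or32.
  (* The third trace at the start is [E (E - lambda) - 2], so the constant 2 takes the place of the
     preceding coordinate [y]. *)
  have [] := @escaping_next E 2 (E - lambda%:C%C) x2 z2.
    by left; rewrite -[2](@rmorph_nat _ _ (real_complex R) 2) /= expr0n addr0 sqrtr_sqr normr_nat.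
  by move=> *; apply: Or33.
rewrite euS evS; case: ifP => _.
  by rewrite trace_uvu (trace_catC _ (ev n)); exact: escaping_or_small_next.
rewrite trace_uvv; apply: escaping_or_smallC.
exact/escaping_or_small_next/escaping_or_smallC.
Qed.

Lemma escaping_atS E n : escaping_at E n -> escaping_at E n.+1.
Proof.
rewrite /escaping_at euS evS => -[x2 y2 xz yz]; case: ifP => _.
  rewrite trace_uvu (trace_catC _ (ev n)).
  by apply: escaping_next => //; [lra|right].
by rewrite trace_uvv; apply/escapingC/escaping_next => //; [lra|right].
Qed.

Lemma escaping_at_le E m n : (m <= n)%N -> escaping_at E m -> escaping_at E n.
Proof.
move=> /subnK <-; elim: (n - m)%N => // k IH /IH.
exact: escaping_atS.
Qed.

(** The polynomial is invariant under the trace map; its value is computed from the initial traces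
    [E], [E - lambda] and [E (E - lambda) - 2]. *)
Lemma fricke E n : let x := trace E (eu n) in let y := trace E (ev n) in
  let z := trace E (eu n ++ ev n) in
  x ^+ 2 + y ^+ 2 + z ^+ 2 - x * y * z = (4 + lambda ^+ 2)%:C%C.
Proof.
elim: n => [|n IH] /=.
  rewrite -[eu 0]/[:: false] -[ev 0]/[:: true] /= trace_start !trace_seq1 mulr0 mulr1 subr0.
  rewrite rmorphD rmorphXn /= -[4]/(4%:R) (rmorph_nat (real_complex R)).
  by ring.
rewrite -IH euS evS; case: ifP => _.
  by rewrite trace_uvu (trace_catC _ (ev n)); ring.
by rewrite trace_uvv; ring.
Qed.

Lemma normc_real (x : R) : normc x%:C%C = `|x|.
Proof. by rewrite /= expr0n addr0 sqrtr_sqr. Qed.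

(** Solving for [x ^+ 2] gives [|x|^2 <= 12 + lambda^2 + 4|x|], hence [|x| <= 2 + sqrt(16 +
    lambda^2) <= 6 + |lambda|]. *)
Lemma fricke_bound (x y z : C) :
  x ^+ 2 + y ^+ 2 + z ^+ 2 - x * y * z = (4 + lambda ^+ 2)%:C%C ->
  normc y <= 2 -> normc z <= 2 -> normc x <= 6 + `|lambda|.
Proof.
move=> e y2 z2.
have ex : x ^+ 2 = ((4 + lambda ^+ 2)%:C%C - y ^+ 2) - (z ^+ 2 - x * y * z).
  by rewrite -e; ring.
have : normc (x ^+ 2) <= (4 + lambda ^+ 2) + normc (y ^+ 2) +
    (normc (z ^+ 2) + normc (x * y * z)).
  rewrite ex; apply: (le_trans (ler_normcB _ _)); apply: lerD; last exact: ler_normcB.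
  apply: (le_trans (ler_normcB _ _)); rewrite normc_real ger0_norm//.
  by apply: addr_ge0 => //; exact: sqr_ge0.
rewrite !expr2 !Normc.normcM.
have := normc_ge0 x; have := normc_ge0 y; have := normc_ge0 z.
have := normr_ge0 lambda; have : lambda * lambda = `|lambda| * `|lambda|.
  by rewrite -normrM ger0_norm// -expr2 sqr_ge0.
move: (normc x) (normc y) (normc z) y2 z2 `|lambda| => a b c b2 c2 l -> l0 c0 b0 a0 h.
have h1 : b * b <= 4 by nra.
have h2 : c * c <= 4 by nra.
have h3 : b * c <= 4 by nra.
have h4 : a * b * c <= a * 4 by rewrite -mulrA ler_wpM2l.
by nra.
Qed.

(* If the trace of the kept word exceeds 2, then those of the word replaced at
   this step and of its replacement do not, and the Fricke invariant bounds the
   remaining coordinate. *)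
Lemma trace_kept_le E n : ~ escaping_at E n -> ~ escaping_at E n.+1 ->
  normc (trace E (kept alpha n)) <= 6 + `|lambda|.
Proof.
move=> n0 n1; have := escaping_or_small_at E n; have := escaping_or_small_at E n.+1.
have := fricke E n; move: n0 n1.
rewrite /escaping_at /kept euS evS /=; case: ifP => _.
  rewrite (trace_catC _ (ev n)) => n0 n1 fr h1 h0.
  have [x2|x2] := leP (normc (trace E (eu n))) 2.
    by have := normr_ge0 lambda; lra.
  apply: fricke_bound fr _ _; first by case: h0 => //; lra.
  by case: h1 => //; lra.
move=> n0 n1 fr h1 h0.
have [x2|x2] := leP (normc (trace E (ev n))) 2.
  by have := normr_ge0 lambda; lra.
apply: (@fricke_bound _ (trace E (eu n)) (trace E (eu n ++ ev n))).
- by rewrite -fr; ring.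
- by case: h0 => //; lra.
- by case: h1 => //; lra.
Qed.

End Trace.

(** * Continuity of the traces in the energy *)

Section Lipschitz.
Variable R : realType.
Local Notation C := R[i].
Implicit Types (E : C) (g h : C -> C).

(** Entries of transfer matrices are polynomials in the energy; a Lipschitz bound on the unit disc
    around [E] passes to sums and products and gives continuity at [E]. *)
Definition lipschitz_near E g := exists2 K : R, 0 <= K &
  forall E', normc (E' - E) <= 1 -> normc (g E' - g E) <= K * normc (E' - E).

Lemma eq_lipschitz_near E g h : (forall E', h E' = g E') ->
  lipschitz_near E g -> lipschitz_near E h.
Proof. by move=> /funext ->. Qed.

Lemma lipschitz_near_cst E (c : C) : lipschitz_near E (fun=> c).
Proof. by exists 0 => // E' _; rewrite subrr Normc.normc0 mul0r. Qed.

Lemma lipschitz_near_id E (c : C) : lipschitz_near E (fun E' => E' - c).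
Proof.
by exists 1 => // E' _; rewrite mul1r (_ : E' - c - (E - c) = E' - E)//; ring.
Qed.

Lemma lipschitz_nearD E g h : lipschitz_near E g -> lipschitz_near E h ->
  lipschitz_near E (fun E' => g E' + h E').
Proof.
move=> [K K0 gK] [L L0 hL]; exists (K + L) => [|E' E1]; first exact: addr_ge0.
rewrite (_ : _ - _ = (g E' - g E) + (h E' - h E)); last by ring.
by rewrite mulrDl; apply: le_trans (le_normcD _ _) (lerD (gK _ E1) (hL _ E1)).
Qed.

Lemma lipschitz_nearM E g h : lipschitz_near E g -> lipschitz_near E h ->
  lipschitz_near E (fun E' => g E' * h E').
Proof.
move=> [K K0 gK] [L L0 hL].
exists ((K + normc (g E)) * L + K * normc (h E)) => [|E' E1].
  by rewrite addr_ge0 ?mulr_ge0 ?addr_ge0 ?normc_ge0.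
rewrite (_ : _ - _ = g E' * (h E' - h E) + (g E' - g E) * h E); last by ring.
apply: le_trans (le_normcD _ _) _; rewrite !Normc.normcM mulrDl.
have gE : normc (g E') <= K + normc (g E).
  have := le_normcB (g E') (g E); have := gK _ E1.
  by have := normc_ge0 (E' - E); nra.
have := gK _ E1; have := hL _ E1.
have := normc_ge0 (h E); have := normc_ge0 (g E'); have := normc_ge0 (g E).
move=> g0 g0' h0 h1 g1; apply: lerD.
  by rewrite -mulrA ler_pM// normc_ge0.
by rewrite mulrAC ler_wpM2r.
Qed.

Variable lambda : R.

Lemma lipschitz_near_transfer1 E b i j :
  lipschitz_near E (fun E' => transfer1 lambda E' b i j).
Proof.
apply: (@eq_lipschitz_near _ (fun E' : C =>
  if i == 0 then (if j == 0 then E' - (lambda * b%:R)%:C%C else -1)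
  else (if j == 0 then 1 else 0))) => [E'|]; first by rewrite mxE.
case: (i == 0); last by case: (j == 0); exact: lipschitz_near_cst.
by case: (j == 0); [exact: lipschitz_near_id|exact: lipschitz_near_cst].
Qed.

Lemma lipschitz_near_transfer E w i j :
  lipschitz_near E (fun E' => transfer lambda E' w i j).
Proof.
elim: w i j => [|b w IH] i j; first exact: lipschitz_near_cst.
apply: (@eq_lipschitz_near _ (fun E' : C =>
  transfer lambda E' w i 0 * transfer1 lambda E' b 0 j +
  transfer lambda E' w i 1 * transfer1 lambda E' b 1 j)) => [E'|].
  by rewrite /= mulmx2E.
by apply: lipschitz_nearD; apply: lipschitz_nearM => //;
  exact: lipschitz_near_transfer1.
Qed.

Lemma lipschitz_near_trace E w :
  lipschitz_near E (fun E' => trace lambda E' w).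
Proof.
apply: (@eq_lipschitz_near _ (fun E' : C =>
  transfer lambda E' w 0 0 + transfer lambda E' w 1 1)) => [E'|].
  by rewrite /trace mxtrace2E.
by apply: lipschitz_nearD; exact: lipschitz_near_transfer.
Qed.

Lemma trace_continuous E w (e : R) : 0 < e -> exists2 d, 0 < d &
  forall E', normc (E' - E) < d ->
    normc (trace lambda E' w - trace lambda E w) < e.
Proof.
move=> e0; have [K K0 hK] := lipschitz_near_trace E w.
exists (Num.min 1 (e / (K + 1))).
  by rewrite lt_min ltr01 divr_gt0//; lra.
move=> E'; rewrite lt_min => /andP[/ltW E1 E2]; apply: le_lt_trans (hK _ E1) _.
move: E2; rewrite ltr_pdivlMr; last by lra.
by have := normc_ge0 (E' - E); nra.
Qed.

Lemma escaping_at_open alpha E n : escaping_at lambda alpha E n ->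
  exists2 c, 0 < c & forall E', normc (E' - E) < c ->
    escaping_at lambda alpha E' n.
Proof.
rewrite /escaping_at.
move: (eu alpha n) (ev alpha n) => u v [x2 y2 xz yz].
pose X := trace lambda E u; pose Y := trace lambda E v.
pose Z := trace lambda E (u ++ v).
have [e e0 [ex ey exz eyz]] : exists2 e : R, 0 < e &
    [/\ 2 + e <= normc X, 2 + e <= normc Y, normc X + 2 * e <= normc Z
      & normc Y + 2 * e <= normc Z].
  (* Half of the smallest gap in the four strict inequalities; the factor 2 is for those in which
     both sides move. *)
  pose e := Num.min (Num.min (normc X - 2) (normc Y - 2))
    (Num.min (normc Z - normc X) (normc Z - normc Y)) / 2.
  exists e; first by rewrite divr_gt0// !lt_min !subr_gt0 x2 y2 xz yz.
  have : e * 2 <= Num.min (Num.min (normc X - 2) (normc Y - 2))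
    (Num.min (normc Z - normc X) (normc Z - normc Y)) by rewrite divfK.
  have e0 : 0 < e by rewrite divr_gt0// !lt_min !subr_gt0 x2 y2 xz yz.
  by rewrite !le_min => /andP[/andP[? ?] /andP[? ?]]; split; lra.
have [d1 d10 h1] := trace_continuous E u e0.
have [d2 d20 h2] := trace_continuous E v e0.
have [d3 d30 h3] := trace_continuous E (u ++ v) e0.
exists (Num.min d1 (Num.min d2 d3)); first by rewrite !lt_min d10 d20 d30.
move=> E'; rewrite !lt_min => /andP[/h1 + /andP[/h2 + /h3]].
rewrite -/X -/Y -/Z; move: (trace _ _ u) (trace _ _ v) (trace _ _ (u ++ v)).
move=> X' Y' Z' hX hY hZ.
have := le_normcB X (X - X'); have := le_normcB Y (Y - Y').
have := le_normcB Z (Z - Z'); rewrite !subKr.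
have := ler_normcB X (X - X'); have := ler_normcB Y (Y - Y').
have nB (s t : C) : normc (s - t) = normc (t - s) by rewrite -normcN opprB.
rewrite !subKr; move: hX hY hZ; rewrite (nB X') (nB Y') (nB Z') => *.
by split; lra.
Qed.

End Lipschitz.

(** * The two-block argument *)

Section Gordon.
Variables (R : realType) (lambda : R).
Local Notation C := R[i].
Implicit Types (E : C) (w : full_shift) (phi : int -> C).

Definition window w n : seq bool := mkseq (fun j => w j%:Z) n.

Definition phase phi (n : int) : 'cV[C]_2 :=
  \col_i if i == 0 then phi n else phi (n - 1).

Lemma phase_transfer1 w E phi (n : int) : is_solution lambda w E phi ->
  transfer1 lambda E (w n) *m phase phi n = phase phi (n + 1).
Proof.
move=> /(_ n); rewrite /schroedinger /potential => sol.
apply/matrixP => i j; rewrite mulmx2E !mxE /=.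
case: ifP => _ /=; last by rewrite mul1r mul0r addr0 addrK.
by apply/eqP; rewrite -subr_eq0 mulrBl -sol; apply/eqP; ring.
Qed.

Lemma phase_transfer w E phi n : is_solution lambda w E phi ->
  transfer lambda E (window w n) *m phase phi 0 = phase phi n%:Z.
Proof.
move=> sol; elim: n => [|n IH]; first by rewrite mul1mx.
rewrite /window mkseqS -cats1 transfer_cat /= mul1mx -mulmxA IH.
by rewrite phase_transfer1// intS addrC.
Qed.

Definition square w p := forall j, (j < p)%N -> w (p + j)%N%:Z = w j%:Z.

Lemma window_square w p : square w p ->
  window w (p + p) = window w p ++ window w p.
Proof.
move=> sq; apply: (@eq_from_nth _ false).
  by rewrite size_cat !size_mkseq.
move=> i; rewrite size_mkseq => ip; rewrite nth_cat size_mkseq nth_mkseq//.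
case: ltnP => h; first by rewrite nth_mkseq.
have lt : (i - p < p)%N by rewrite ltn_subLR.
by rewrite nth_mkseq// -(sq _ lt) subnKC.
Qed.

(** Cayley-Hamilton, [M^2 = tr M * M - 1], for the transfer matrix [M] over one block, applied to
    the phase at 0. *)
Lemma two_block w E phi p : is_solution lambda w E phi -> square w p ->
  phase phi 0 = trace lambda E (window w p) *: phase phi p - phase phi (p + p)%N.
Proof.
move=> sol sq; rewrite -(phase_transfer (p + p) sol) -(phase_transfer p sol) window_square// transfer_cat.
rewrite mulmx2_det1 ?det_transfer// mulmxBl mul1mx -scalemxAl opprB addrC.
by rewrite subrK.
Qed.

Lemma phase0_eq0 w E phi : is_solution lambda w E phi -> phase phi 0 = 0 ->
  forall n, phi n = 0.
Proof.
move=> sol ph0.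
have step n : phase phi n = 0 -> phase phi (n + 1) = 0.
  by move=> h; rewrite -(phase_transfer1 _ sol) h mulmx0.
have back n : phase phi n = 0 -> phase phi (n - 1) = 0.
  have := det_transfer lambda E [:: w (n - 1)]; rewrite /= mul1mx => d.
  have := @phase_transfer1 w E phi (n - 1) sol; rewrite subrK => <- h.
  have u : transfer1 lambda E (w (n - 1)) \in unitmx by rewrite unitmxE d unitr1.
  by rewrite -(mulKmx u (phase _ _)) h mulmx0.
suff all0 n : phase phi n = 0.
  by move=> n; have /matrixP/(_ 0 0) := all0 n; rewrite !mxE.
elim: n => // n.
  by rewrite intS addrC; exact: step.
by move=> /back; rewrite (_ : - n%:Z - 1 = - n.+1%:Z)//; lia.
Qed.

(** A solution square-summable at +oo tends to 0 there, so its phases at [p] and [p + p] become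
    arbitrarily small; as the traces stay bounded, [two_block] makes the phase at 0 vanish. *)
Lemma no_ell2_solution_of_squares w E (M : R) :
  (forall N, exists p, [/\ (N <= p)%N, square w p &
     normc (trace lambda E (window w p)) <= M]) ->
  no_ell2_solution_at false lambda w E.
Proof.
move=> squares phi sol [n0 phin0]; apply: contrapT => /eqP sum_fin.
have M0 : 0 <= M.
  by have [p [_ _]] := squares 0%N; apply: le_trans; exact: normc_ge0.
have cvg0 : normc (phi n%:Z) ^+ 2 @[n --> \oo] --> (0 : R).
  apply: cvg_series_cvg_0; apply: nnseries_is_cvg => [i|]; first exact: sqr_ge0.
  rewrite ltey; apply: contra sum_fin => /eqP <-; apply/eqP.
  by apply: eq_eseriesr => i _; rewrite /abs2 expr0 mul1r.
have small (e : R) : 0 < e -> exists N, forall n, (N <= n)%N -> normc (phi n%:Z) < e.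
  move=> e0; have /cvgrPdist_lt/(_ (e ^+ 2)) := cvg0.
  rewrite exprn_gt0// => /(_ isT)[N _ hN]; exists N => n /hN /=.
  rewrite sub0r normrN ger0_norm ?sqr_ge0// ltr_pXn2r// nnegrE ?normc_ge0//.
  exact: ltW.
suff ph0 : phase phi 0 = 0.
  by move: phin0; rewrite (phase0_eq0 sol ph0) eqxx.
have bound (x : C) : (forall e : R, 0 < e -> normc x <= M * e + e) -> x = 0.
  move=> hx; apply: Normc.eq0_normc; apply/eqP; rewrite eq_le normc_ge0 andbT.
  apply/ler_addgt0Pl => e e0; rewrite addr0.
  have := hx (e / (M + 1)); rewrite divr_gt0//; last by lra.
  move=> /(_ isT); rewrite -{2}[_ / _]mul1r -mulrDl mulrC divfK//.
  by apply/eqP; lra.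
have bnd i : phase phi 0 i 0 = 0.
  apply: bound => e e0; have [N hN] := small e e0.
  (* [N.+1] and not [N], because the phase at [q] also contains the value at [q - 1]. *)
  have [p [Np sq trM]] := squares N.+1.
  have /matrixP/(_ i 0) -> := two_block sol sq.
  have ph q : (N.+1 <= q)%N -> normc (phase phi q%:Z i 0) <= e.
    move=> Nq; rewrite mxE; case: ifP => _; first by apply/ltW/hN; lia.
    have -> : q%:Z - 1 = q.-1%:Z by lia.
    by apply/ltW/hN; lia.
  rewrite !mxE; have := ph p Np; have := ph (p + p)%N; rewrite !mxE.
  rewrite (leq_trans Np (leq_addr _ _)) => /(_ isT) h2 h1.
  apply: le_trans (ler_normcB _ _) _; apply: lerD h2.
  by rewrite Normc.normcM ler_pM// ?normc_ge0.
by apply/matrixP => i j; rewrite ord1 bnd mxE.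
Qed.

End Gordon.

(** * Frequency of squares in the hull *)

Section Cylinders.

Lemma nbhs_bool (b : bool) : nbhs b [set b].
Proof. by apply: open_nbhs_nbhs; split => //; exact: discrete_open. Qed.

Lemma coordinate_continuous (n : int) : continuous (fun w : full_shift => w n).
Proof. exact: (@proj_continuous int (fun=> bool) n). Qed.

Lemma measurable_coordinate (n : int) (b : bool) :
  measurable [set w : borel_full_shift | w n = b].
Proof.
apply: sub_sigma_algebra.
have /continuousP /(_ [set b]) := @coordinate_continuous n.
by apply; exact: discrete_open.
Qed.

Lemma measurable_cylinder (c : nat -> int) n (P : set (seq bool)) :
  measurable [set w : borel_full_shift | P (mkseq (fun j => w (c j)) n)].
Proof.
elim: n P => [|n IH] P.
  have [p|np] := pselect (P [::]).
    by rewrite (_ : mkset _ = setT)//; apply/seteqP; split.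
  by rewrite (_ : mkset _ = set0)//; apply/seteqP; split.
rewrite (_ : mkset _ =
    ([set w : borel_full_shift | w (c n) = true] `&`
     [set w : borel_full_shift | [set s | P (rcons s true)] (mkseq (fun j => w (c j)) n)]) `|`
    ([set w : borel_full_shift | w (c n) = false] `&`
     [set w : borel_full_shift | [set s | P (rcons s false)] (mkseq (fun j => w (c j)) n)])).
  by apply: measurableU; apply: measurableI => //; apply: measurable_coordinate.
apply/seteqP; split => w /=; rewrite mkseqS.
  by case: (w (c n)); [left|right].
by case => -[->].
Qed.

End Cylinders.

(** * The hull in terms of finite windows, and its measurability *)

Section Hull.
Variables (R : realType) (alpha : R).

Lemma iter_shift k (w : full_shift) (n : int) : iter k shift_map w n = w (n + k%:Z).
Proof.
elim: k w n => [|k IH] w n; first by rewrite addr0.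
by rewrite iterSr IH /shift_map; congr (w _); lia.
Qed.

Definition agrees_at (w : full_shift) L (m : nat) := forall j, (j <= L)%N ->
  w j%:Z = sturmian_word alpha (j%:Z + m%:Z) /\
  w (- j%:Z) = sturmian_word alpha (- j%:Z + m%:Z).

(** Convergence in the product topology is eventual agreement on every window [[-L, L]]. In this
    form the hull is visibly built from cylinders by countable operations. For the converse the
    shifts are chosen diagonally, with [L = N = i]. *)
Lemma sturmian_hullP w : sturmian_hull alpha w <->
  forall L N, exists2 m, (N <= m)%N & agrees_at w L m.
Proof.
split=> [[k koo kcvg] L N|h].
  have ev (n : int) : \forall i \near \oo,
      iter (k i) shift_map (sturmian_word alpha) n = w n.
    have [M _ hM] := kcvg _ (@coordinate_continuous n w _ (@nbhs_bool (w n))).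
    by exists M => // i /hM.
  have evL : \forall i \near \oo, forall j, (j <= L)%N ->
      iter (k i) shift_map (sturmian_word alpha) j%:Z = w j%:Z /\
      iter (k i) shift_map (sturmian_word alpha) (- j%:Z) = w (- j%:Z).
    elim: L => [|L IH].
      near=> i => j; rewrite leqn0 => /eqP ->; rewrite oppr0.
      by have : iter (k i) shift_map (sturmian_word alpha) 0 = w 0 by near: i; exact: ev.
    near=> i => j; rewrite leq_eqVlt => /predU1P[->|].
      by split; near: i; exact: ev.
    by move: j; near: i.
  have [i [iN iL]] : exists i, (N <= k i)%N /\ forall j, (j <= L)%N ->
      iter (k i) shift_map (sturmian_word alpha) j%:Z = w j%:Z /\
      iter (k i) shift_map (sturmian_word alpha) (- j%:Z) = w (- j%:Z).
    near \oo => i; exists i; split; near: i => //.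
    exact: (koo _ (nbhs_infty_ge N)).
  exists (k i) => // j /iL[<- <-]; by rewrite !iter_shift.
have /choice[k hk] : forall i, exists m, (i <= m)%N /\ agrees_at w i m.
  by move=> i; have [m] := h i i; exists m.
exists k.
  move=> A [M _ hM]; exists M => // i /= Mi; apply: hM => /=.
  by apply: leq_trans Mi _; have [] := hk i.
apply/cvg_sup => n A [_ [[B oB <-] Bw BA]].
exists `|n|%N => // i /= ni; have [_ /(_ `|n|%N ni)] := hk i.
move=> [h1 h2]; apply: BA; rewrite /= /proj iter_shift.
suff -> : sturmian_word alpha (n + (k i)%:Z) = w n by [].
have [n0|n0] := lerP 0 n.
  by have e : n = `|n|%N%:Z by [lia]; rewrite e -h1 -e.
by have e : n = - `|n|%N%:Z by [lia]; rewrite e -h2 -e.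
Unshelve. all: by end_near.
Qed.

Lemma measurable_hull : measurable (sturmian_hull alpha : set borel_full_shift).
Proof.
rewrite (_ : sturmian_hull alpha = \bigcap_L \bigcap_N
   \bigcup_(m in [set m | (N <= m)%N]) \bigcap_(j in [set j | (j <= L)%N])
   ([set w : borel_full_shift | w j%:Z = sturmian_word alpha (j%:Z + m%:Z)] `&`
    [set w : borel_full_shift | w (- j%:Z) = sturmian_word alpha (- j%:Z + m%:Z)])).
  apply: bigcapT_measurable => L; apply: bigcapT_measurable => N.
  apply: bigcup_measurable => m _; apply: bigcap_measurableType => j _.
  by apply: measurableI; exact: measurable_coordinate.
apply/seteqP; split => w.
  move=> /sturmian_hullP h L _ N _; have [m Nm hm] := h L N.
  by exists m => // j /hm.
move=> h; apply/sturmian_hullP => L N; have [m Nm hm] := h L Logic.I N Logic.I.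
by exists m => // j /hm.
Qed.

End Hull.

(** * Lower bound for the measure of the elements that begin with a square *)

Section Measure.
Variables (R : realType) (alpha : R).
Local Notation f := (rotation alpha).

Definition squares_of (u : seq bool) : set borel_full_shift :=
  [set w | square w (size u) /\
     exists k, iter k (rot 1) (window w (size u)) = u].

Lemma measurable_shift_squares u i :
  measurable [set w : borel_full_shift | squares_of u (iter i shift_map w)].
Proof.
set p := size u.
pose P : set (seq bool) := [set s |
  (forall j, (j < p)%N -> nth false s (p + j)%N = nth false s j) /\
  exists k, iter k (rot 1) (take p s) = u].
rewrite (_ : mkset _ = [set w : borel_full_shift |
  P (mkseq (fun j => w (j%:Z + i%:Z)) (p + p)%N)]).
  exact: (@measurable_cylinder (fun j => j%:Z + i%:Z)).
have tk (w : full_shift) : take p (mkseq (fun j => w (j%:Z + i%:Z)) (p + p)%N) =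
    window (iter i shift_map w) p.
  apply: (@eq_from_nth _ false).
    by rewrite size_takel size_mkseq ?leq_addr// size_mkseq.
  rewrite size_takel ?size_mkseq ?leq_addr// => j jp.
  by rewrite nth_take// !nth_mkseq ?iter_shift//; lia.
apply/seteqP; split => w [h1 h2]; split; rewrite ?tk// -?tk//.
  move=> j jp; have := h1 j jp; rewrite !iter_shift !nth_mkseq//; lia.
move=> j jp; have := h1 j jp; rewrite !iter_shift !nth_mkseq//; lia.
Qed.

Lemma measurable_squares u : measurable (squares_of u).
Proof. exact: (measurable_shift_squares u 0). Qed.

Hypothesis halpha : 0 < alpha < 1.
Hypothesis hirr : irrational alpha.

Lemma hull_cover n (w : full_shift) : sturmian_hull alpha w ->
  (size (kept alpha n) <= 2 * size (other alpha n))%N ->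
  (1 < size (other alpha n))%N ->
  exists2 i, (i < 7)%N & squares_of (kept alpha n)
    (iter (i * (size (other alpha n)).-1) shift_map w).
Proof.
move=> /sturmian_hullP hull le_wo o1.
have [m mw] := kept_marked halpha hirr n.
set p := size (kept alpha n) in le_wo *; set q := size (other alpha n) in le_wo o1 *.
(* Room for a starting position of at most [7 * q] and the two blocks of length [p] read from
   there. *)
have [N _ agree] := hull (7 * q + p + p)%N 0%N.
(* One step before the point that codes position [N] of the Sturmian word, because [marked_period]
   needs both [y] and [f y] outside the marker. The [p + 1] free positions thus give the [p]
   equalities of a square. *)
pose y := iter N f 0.
have yI k : alpha - 1 <= iter k f y < alpha.
  by apply: iter_rotation_itv => //; apply: iter_rotation_itv => //;
     have := halpha; lra.
have [i i7 free] := marked_cover y mw le_wo o1.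
exists i => //; set t := (i * q.-1)%N in free *.
have t7 : (t <= 7 * q)%N by apply: leq_mul; lia.
have wE (j : nat) : (j < p + p)%N ->
    iter t shift_map w j%:Z = letter (iter j f (f (iter t f y))).
  move=> jp; have jt : (j + t <= 7 * q + p + p)%N by lia.
  rewrite iter_shift -PoszD (agree _ jt).1 -PoszD sturmian_wordE//.
  by rewrite -iterSr /y -iterS -!iterD; congr (letter (iter _ f 0)); lia.
split=> [j jp|].
  have fE k : iter k f (f (iter t f y)) = f (iter (k + t) f y).
    by rewrite -iterSr iterS -iterD.
  rewrite !wE; [|lia..]; rewrite !fE -addnA iterD -iterS iterSr.
  apply: (marked_period mw) => //; first by apply: free; lia.
  by rewrite -iterS; apply: free; lia.
have -> : window (iter t shift_map w) p = coding alpha (f (iter t f y)) p.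
  apply: (@eq_from_nth _ false); first by rewrite size_mkseq size_coding.
  by move=> j; rewrite size_mkseq => jp; rewrite nth_mkseq// nth_coding// wE//; lia.
by apply: marked_conjugate mw _ _ => //; apply: free; lia.
Qed.

Variable mu : probability borel_full_shift R.
Hypothesis hmu : invariant_on_hull alpha mu.

Lemma mu_shift_squares u i :
  mu [set w | squares_of u (iter i shift_map w)] = mu (squares_of u).
Proof.
elim: i => [//|i IH]; rewrite -IH -(hmu.1 _ (measurable_shift_squares u i)).
by congr (mu _); apply/seteqP; split => w /=; rewrite -iterSr.
Qed.

(** Seven shifted preimages of [squares_of] cover the hull, which has measure 1, and by invariance
    all seven have the same measure. *)
Lemma mu_squares n : (size (kept alpha n) <= 2 * size (other alpha n))%N ->
  (1 < size (other alpha n))%N ->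
  ((7^-1)%:E <= mu (sturmian_hull alpha `&` squares_of (kept alpha n)))%E.
Proof.
move=> le_wo o1; set H := sturmian_hull alpha; set G := squares_of _.
have mH : measurable (H : set borel_full_shift) by exact: measurable_hull.
have mG : measurable G by exact: measurable_squares.
have muH : mu H = 1%E := hmu.2.
have -> : mu (H `&` G) = mu G.
  rewrite [RHS](measureDI mu mG mH) [X in (X + _)%E](_ : _ = 0%E) ?add0e 1?setIC//.
  apply/eqP; rewrite -measure_le0.
  apply: (@le_trans _ _ (mu (~` H))).
    by apply: le_measure; [rewrite inE; exact: measurableD|
      rewrite inE; exact: measurableC|move=> ? []].
  by rewrite probability_setC// muH subee.
pose Gi i := [set w : borel_full_shift |
  squares_of (kept alpha n) (iter (i * (size (other alpha n)).-1) shift_map w)].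
have mGi i : measurable (Gi i) by exact: measurable_shift_squares.
have : (1 <= \sum_(i < 7) mu (Gi i))%E.
  rewrite -muH; apply: le_trans (Boole_inequality _ _) => [|i _]; last exact: mGi.
  apply: le_measure; rewrite ?inE//; first exact: bigsetU_measurable.
  move=> w /hull_cover -/(_ n le_wo o1)[i i7 Gw].
  by rewrite -bigcup_mkord; exists i.
under eq_bigr do rewrite mu_shift_squares.
rewrite -/G; have : mu G \is a fin_num by exact: fin_num_measure.
move=> /fineK <-; rewrite sumEFin !lee_fin sumr_const card_ord -mulr_natr.
by lra.
Qed.

(** The limit superior is a decreasing intersection of unions, each of measure at least 1/7, so
    continuity from above applies. *)
Lemma mu_limsup_squares : exists2 k : nat -> nat, (forall n, (n <= k n)%N) &
  (0 < mu (lim_sup_set (fun n =>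
     sturmian_hull alpha `&` squares_of (kept alpha (k n)))))%E.
Proof.
have [N0 hN0] := size_kept_infty halpha hirr 2.
have /choice[k hk] : forall n, exists m, [/\ (n <= m)%N,
    (size (kept alpha m) <= 2 * size (other alpha m))%N &
    (1 < size (other alpha m))%N].
  move=> n; have [m nm wo] := size_kept_le_other alpha (maxn n N0).
  exists m; split => //; first by move: nm; rewrite geq_max => /andP[].
  by apply: (hN0 m _).2; move: nm; rewrite geq_max => /andP[].
exists k => [n|]; first by have [] := hk n.
pose F n : set borel_full_shift :=
  sturmian_hull alpha `&` squares_of (kept alpha (k n)).
rewrite -/F.
have mF n : measurable (F n).
  by apply: measurableI; [exact: measurable_hull|exact: measurable_squares].
apply: (@lt_le_trans _ _ (7^-1)%:E); first by rewrite lte_fin invr_gt0.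
have := @lim_sup_set_cvg _ _ _ mu F mF _.
move=> /(_ _)/cvge_to_ge; apply.
  apply: le_lt_trans (probability_le1 mu _) _; last exact: ltry.
  exact: bigcup_measurable.
apply: nearW => n; have [_ wo o1] := hk n.
apply: le_trans (mu_squares wo o1) _.
apply: le_measure; first by rewrite inE; exact: (mF n).
  by rewrite inE; exact: bigcup_measurable.
by move=> w Fw; exists n => /=.
Qed.

End Measure.

(** * Periodic approximation of the resolvent *)

Section SquareNorm.
Local Open Scope sesquilinear_scope.
Variable R : realType.
Local Notation C := R[i].

Definition sqnorm n (psi : 'cV[C]_n) : R := \sum_i normc (psi i 0) ^+ 2.

Lemma normcEC (z : C) : `|z| = (normc z)%:C%C.
Proof. by case: z. Qed.

Lemma sqnormE n (psi : 'cV[C]_n) : (sqnorm psi)%:C%C = (psi^t* *m psi) 0 0.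
Proof.
rewrite /sqnorm rmorph_sum mxE; apply: eq_bigr => i _.
by rewrite rmorphXn /= -normcEC normCK !mxE mulrC.
Qed.

Lemma sqnorm_unitary n (P : 'M[C]_n) (psi : 'cV[C]_n) : P \is unitarymx ->
  sqnorm (P *m psi) = sqnorm psi.
Proof.
move=> /unitarymxP /mulmx1C PP; apply: (@complexI R).
by rewrite !sqnormE trmx_mul map_mxM -mulmxA (mulmxA (P^t*)) PP mul1mx.
Qed.

Lemma sqnorm_diag n (e : 'rV[C]_n) (psi : 'cV[C]_n) (rho : R) : 0 <= rho ->
  (forall i, normc (e 0 i) <= rho) ->
  sqnorm (diag_mx e *m psi) <= rho ^+ 2 * sqnorm psi.
Proof.
move=> rho0 erho; rewrite /sqnorm mulr_sumr; apply: ler_sum => i _.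
rewrite mul_diag_mx mxE Normc.normcM exprMn ler_wpM2r ?sqr_ge0//.
by rewrite lerXn2r ?nnegrE ?normc_ge0.
Qed.

(* The polynomial [1 - t (d - conj z) (d - z)] contracts a spectrum at distance
   between [c] and [t^(-1/2)] from [z]. *)
Lemma sqnorm_contraction n (A : 'M[C]_n) (z : C) (t c : R) :
  A \is symmetricmx -> A \is a realmx -> 0 <= t -> 0 <= c ->
  (forall (d : C) (psi : 'cV[C]_n), A *m psi = d *: psi -> psi != 0 ->
     c <= normc (d - z) /\ t * normc (d - z) ^+ 2 <= 1) ->
  forall psi : 'cV[C]_n,
  sqnorm (psi - t%:C%C *: ((A - (z^*)%C%:M) *m ((A - z%:M) *m psi))) <=
    (1 - t * c ^+ 2) ^+ 2 * sqnorm psi.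
Proof.
move=> Asym Areal t0 c0 hA psi.
have Aherm := realsym_hermsym Asym Areal.
have dreal := hermitian_spectral_diag_real Aherm.
have /orthomx_spectralP := hermitian_normalmx Aherm.
have Pu := spectral_unitarymx A.
move: (spectralmx A) (spectral_diag A) dreal Pu => P d dreal Pu AE.
have Punit := unitarymx_unit Pu.
have AT : A^T = A.
  by have := is_hermitianmxP _ _ _ Asym; rewrite expr0 scale1r map_mx_id.
have eig i : c <= normc (d 0 i - z) /\ t * normc (d 0 i - z) ^+ 2 <= 1.
  (* [P A = diag(d) P], and [A] is symmetric: transposing a row of [P] gives a column
     eigenvector. *)
  apply: (hA (d 0 i) (row i P)^T).
    rewrite -{1}AT -trmx_mul -row_mul {1}AE !mulmxA mulmxV// mul1mx.
    by apply/matrixP => j k; rewrite mul_diag_mx !mxE.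
  apply: contraTneq Punit => /(congr1 trmx); rewrite trmxK trmx0 => Pi0.
  apply/negP => Punit; have := congr1 (mulmx^~ (invmx P)) Pi0.
  rewrite /= mul0mx -row_mul mulmxV// => /matrixP/(_ 0 i)/eqP.
  by rewrite !mxE eqxx oner_eq0.
(* The [d 0 i] are real, so [(d - conj z)(d - z) = |d - z|^2], and the polynomial in [A] has the
   eigenvalues [e]. *)
pose e : 'rV[C]_n := \row_i (1 - t * normc (d 0 i - z) ^+ 2)%:C%C.
have -> : psi - t%:C%C *: ((A - (z^*)%C%:M) *m ((A - z%:M) *m psi)) =
    invmx P *m (diag_mx e *m (P *m psi)).
  have shift y : A - y%:M = invmx P *m (diag_mx d - y%:M) *m P.
    rewrite mulmxBr mulmxBl -[in RHS]AE; congr (_ - _).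
    by rewrite -[in RHS]scalemx1 -scalemxAr -scalemxAl mulmx1 mulVmx// scalemx1.
  have -> : diag_mx e = 1%:M - t%:C%C *: ((diag_mx d - (z^*)%C%:M) *m (diag_mx d - z%:M)).
    apply/matrixP => i j; rewrite -!diag_const_mx -!raddfB /= mulmx_diag.
    rewrite !mxE; case: eqP => [->|_]; last by rewrite !mulr0n mulr0 subr0.
    have /mxOverP/(_ 0 j)/CrealP dj := dreal.
    rewrite !mulr1n rmorphB rmorphM rmorphXn /= -normcEC normCK rmorphB /= dj.
    by rewrite rmorph1 [(_ - z^*) * _]mulrC.
  rewrite !shift; move: (diag_mx d - _) (diag_mx d - _) => D1 D2.
  rewrite mulmxBl mul1mx mulmxBr mulKmx//; congr (_ - _).
  by rewrite -!scalemxAl -scalemxAr !mulmxA mulmxK.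
have PI := invmx_unitary Pu.
have Pt : P^t* \is unitarymx by rewrite trmxC_unitary.
have Pu' : invmx P \is unitarymx by rewrite PI.
rewrite (sqnorm_unitary _ Pu').
rewrite -(sqnorm_unitary psi Pu).
have e1 (i : 'I_n) : 0 <= 1 - t * normc (d 0 i - z) ^+ 2 <= 1 - t * c ^+ 2.
  have [ci ti] := eig i; rewrite subr_ge0 ti /= lerB// ler_wpM2l//.
  by rewrite lerXn2r// nnegrE normc_ge0.
(* The sign of [1 - t * c ^+ 2] is read off from an eigenvalue, so the empty matrix is treated
   apart. *)
have [n0|n0] := posnP n.
  by rewrite /sqnorm !big1 ?mulr0// => -[m mn]; exfalso; rewrite n0 in mn.
apply: sqnorm_diag => [|i]; first by have /andP[/le_trans h /h] := e1 (Ordinal n0).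
have /andP[e0 ele] := e1 i.
by rewrite mxE normc_real ger0_norm.
Qed.

End SquareNorm.

(** * The Schroedinger operator on a cycle *)

Section Cyclic.
Local Open Scope sesquilinear_scope.
Variables (R : realType) (lambda : R) (q : nat).
Local Notation C := R[i].
Variable W : seq bool.
Hypothesis sizeW : size W = q.+2.

Definition cyclic_potential (i : 'I_q.+2) : C :=
  (lambda * (nth false W i)%:R)%:C%C.

(* For [q = 0] the two neighbours of a site coincide and are counted twice. *)
Definition cyclic_schroedinger : 'M[C]_q.+2 :=
  \matrix_(i, j) ((j == i + 1)%:R + (j == i - 1)%:R + cyclic_potential i *+ (i == j)).

Local Notation A := cyclic_schroedinger.

Lemma mul_cyclic (psi : 'cV[C]_q.+2) i :
  (A *m psi) i 0 = psi (i + 1) 0 + psi (i - 1) 0 + cyclic_potential i * psi i 0.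
Proof.
have pick (k : 'I_q.+2) (x : C) : \sum_j x *+ (k == j) * psi j 0 = x * psi k 0.
  rewrite (bigD1 k)//= eqxx mulr1n big1 ?addr0// => j /negPf jk.
  by rewrite eq_sym jk mulr0n mul0r.
rewrite mxE -[psi (i + 1) 0]mul1r -[psi (i - 1) 0]mul1r -!pick -!big_split /=.
apply: eq_bigr => j _; rewrite !mxE !mulrDl; congr (_ * _ + _ * _ + _).
  by rewrite eq_sym.
by rewrite eq_sym.
Qed.

Lemma cyclic_symmetric : A \is symmetricmx.
Proof.
apply/is_hermitianmxP; rewrite expr0 scale1r map_mx_id//.
apply/matrixP => i j; rewrite !mxE.
have -> : (i == j + 1) = (j == i - 1).
  by apply/eqP/eqP => ->; rewrite ?addrK ?subrK.
have -> : (i == j - 1) = (j == i + 1).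
  by apply/eqP/eqP => ->; rewrite ?addrK ?subrK.
rewrite [X in _ = X + _]addrC; congr (_ + _).
by rewrite eq_sym; case: eqP => [->|].
Qed.

Lemma cyclic_real : A \is a realmx.
Proof.
apply/mxOverP => i j; rewrite mxE; apply: rpredD; first by apply: rpredD; exact: realn.
by apply: rpredMn; apply/complex_realP; eexists.
Qed.

(** Compare both sides of the eigenvalue equation at a site where the modulus of [psi] is
    largest. *)
Lemma cyclic_eigenvector_bound (d : C) (psi : 'cV[C]_q.+2) :
  A *m psi = d *: psi -> psi != 0 -> normc d <= 2 + `|lambda|.
Proof.
move=> Ad psi0.
have [i _ imax] := @arg_maxP _ R _ (0 : 'I_q.+2) xpredT (fun j => normc (psi j 0)) isT.
have psii : 0 < normc (psi i 0).
  rewrite lt_neqAle normc_ge0 andbT eq_sym; apply: contra psi0 => /eqP pi0.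
  apply/eqP/matrixP => j k; rewrite ord1 mxE; apply: Normc.eq0_normc.
  by apply: le_anti; rewrite normc_ge0 andbT -pi0; exact: imax.
have /matrixP/(_ i 0) := Ad; rewrite mul_cyclic [RHS]mxE => e.
have : normc (d * psi i 0) <= (2 + `|lambda|) * normc (psi i 0).
  rewrite -e mulrDl; apply: le_trans (le_normcD _ _) (lerD _ _).
    apply: le_trans (le_normcD _ _) _.
    by rewrite mulr_natl mulr2n; apply: lerD; exact: imax.
  rewrite Normc.normcM ler_wpM2r ?normc_ge0// normc_real normrM.
  by case: (nth _ _ _); rewrite ?normr1 ?normr0 ?mulr1 ?mulr0.
by rewrite Normc.normcM ler_pM2r.
Qed.

(* An eigenvector is a periodic solution, that is, a fixed vector of the
   transfer matrix over one period. *)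
Lemma cyclic_eigenvalue_trace (d : C) (psi : 'cV[C]_q.+2) :
  A *m psi = d *: psi -> psi != 0 -> trace lambda d W = 2.
Proof.
move=> Ad psi0.
pose ph (i : 'I_q.+2) : 'cV[C]_2 := \col_k if k == 0 then psi i 0 else psi (i - 1) 0.
have step (i : 'I_q.+2) : transfer1 lambda d (nth false W i) *m ph i = ph (i + 1).
  apply/matrixP => k l; rewrite mulmx2E !mxE /=.
  case: ifP => _ /=; last by rewrite mul1r mul0r addr0 addrK.
  have /matrixP/(_ i 0) := Ad; rewrite mul_cyclic [RHS]mxE.
  rewrite /cyclic_potential mulrBl => <-; ring.
have iter_step k : (k <= q.+2)%N ->
    transfer lambda d (take k W) *m ph 0 = ph k%:R.
  elim: k => [|k IH] kq; first by rewrite take0 mul1mx.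
  rewrite (take_nth false) ?sizeW// -cats1 transfer_cat /= mul1mx -mulmxA IH 1?ltnW//.
  rewrite -natr1 -step; congr (transfer1 _ _ _ *m _).
  by congr (nth _ _ _); rewrite Zp_nat /= modn_small.
have fixed : transfer lambda d W *m ph 0 = ph 0.
  by have := iter_step q.+2 (leqnn _); rewrite take_oversize ?sizeW// => ->; rewrite (@pchar_Zp q.+2).
have ph0 : ph 0 != 0.
  apply: contra psi0 => /eqP ph0; apply/eqP/matrixP => i j.
  have := iter_step i (ltnW (ltn_ord i)); rewrite ph0 mulmx0 natr_Zp.
  by move=> /matrixP/(_ 0 0); rewrite !mxE /= ord1.
have /eqP : (trace lambda d W - 2) *: ph 0 = 0.
  have := mulmx2_det1 (det_transfer lambda d W).
  move=> /(congr1 (mulmx^~ (ph 0))); rewrite /= -mulmxA !fixed mulmxBl mul1mx.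
  rewrite -scalemxAl fixed => e; rewrite scalerBl -{2}(addrK (ph 0) (ph 0)).
  rewrite /trace scaler_nat mulr2n addrK; apply/eqP; rewrite subr_eq add0r.
  by rewrite -subr_eq -e.
by rewrite scaler_eq0 (negPf ph0) orbF subr_eq0 => /eqP.
Qed.

End Cyclic.

(** * Square-summability through finite windows *)

Section EllTwoBound.
Variable R : realType.
Local Notation C := R[i].
Implicit Types (phi psi : int -> C) (a m : nat) (s : R).

Definition window_sum phi a m : R :=
  \sum_(i < m) normc (phi (i%:Z - a%:Z)) ^+ 2.

(** States that the squared norm is at most [s]. Bounding finite windows only makes it stable under
    pointwise limits and suited to comparison with cycles. *)
Definition ell2_le phi s := forall a m, window_sum phi a m <= s.

Lemma window_sum_shift phi a m b : (b <= a)%N ->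
  window_sum phi b m = \sum_(a - b <= i < a - b + m) normc (phi (i%:Z - a%:Z)) ^+ 2.
Proof.
move=> ba; rewrite -{1}[(a - b)%N]add0n big_addn addKn big_mkord.
apply: eq_bigr => i _; congr (normc (phi _) ^+ 2); lia.
Qed.

Lemma sum_nat_sub (g : nat -> R) k m n : (forall i, 0 <= g i) ->
  (k + m <= n)%N -> \sum_(k <= i < k + m) g i <= \sum_(0 <= i < n) g i.
Proof.
move=> g0 kmn; rewrite (big_cat_nat (leq0n k) (leq_trans (leq_addr m k) kmn)) /=.
rewrite (big_cat_nat (leq_addr m k) kmn) /= addrCA lerDl.
by rewrite addr_ge0// sumr_ge0.
Qed.

Lemma esum_ge_window_sum phi a m :
  ((window_sum phi a m)%:E <= \esum_(n in [set: int]) abs2 (phi n))%E.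
Proof.
pose r := [seq i%:Z - a%:Z | i <- iota 0 m].
apply: esum_ge; exists [set` r]; first by split => //; exact: finite_seq.
rewrite -fsbig_seq; last by rewrite map_inj_uniq ?iota_uniq// => i j; lia.
rewrite big_map /window_sum -sumEFin.
by rewrite -(big_mkord xpredT (fun i => abs2 (phi (i%:Z - a%:Z)))) /index_iota subn0.
Qed.

Lemma esum_le_window_sum phi s : ell2_le phi s ->
  (\esum_(n in [set: int]) abs2 (phi n) <= s%:E)%E.
Proof.
move=> phis; apply: ge_ereal_sup => _ [X [finX _] <-].
have [K hK] : exists K : nat, forall n, X n -> (`|n|%N <= K)%N.
  have /finite_seqP[r ->] := finX.
  exists (\max_(n <- r) `|n|%N)%N => n /= nr.
  by rewrite (big_rem n)//= leq_maxl.
apply: (@le_trans _ _ (window_sum phi K (K + K).+1)%:E); last by rewrite lee_fin.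
pose r := [seq i%:Z - K%:Z | i <- iota 0 (K + K).+1].
apply: (@le_trans _ _ (\sum_(n \in [set` r]) abs2 (phi n))%E).
  apply: lee_fsum_nneg_subset => //; first exact: finite_seq.
  - move=> n; rewrite inE => /hK nK; rewrite inE /=.
    apply/mapP; have {}nK : (`|n : int|%N <= K)%N := nK.
    exists (absz ((n : int) + K%:Z)%R); last by lia.
    by rewrite mem_iota; lia.
  - by move=> n _; rewrite lee_fin sqr_ge0.
rewrite -fsbig_seq; last by rewrite map_inj_uniq ?iota_uniq// => i j; lia.
rewrite big_map /window_sum -sumEFin.
by rewrite -(big_mkord xpredT (fun i => abs2 (phi (i%:Z - K%:Z)))) /index_iota subn0.
Qed.

Lemma ell2_leP phi s : ell2_le phi s <-> (\esum_(n in [set: int]) abs2 (phi n) <= s%:E)%E.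
Proof.
split=> [|h a m]; first exact: esum_le_window_sum.
by rewrite -lee_fin; apply: le_trans (esum_ge_window_sum _ _ _) h.
Qed.

Lemma esum_abs2_ge0 phi : (0 <= \esum_(n in [set: int]) abs2 (phi n))%E.
Proof. by apply: esum_ge0 => n _; rewrite lee_fin sqr_ge0. Qed.

Lemma ell2E phi : ell2 phi <-> (\esum_(n in [set: int]) abs2 (phi n) < +oo)%E.
Proof.
rewrite /ell2 /= /summable.
have -> : (\esum_(n in [set: int]) `|abs2 (phi n)| =
    \esum_(n in [set: int]) abs2 (phi n))%E; last by [].
by apply: eq_esum => n _; rewrite gee0_abs// lee_fin sqr_ge0.
Qed.

Lemma ell2_le_ell2 phi s : ell2_le phi s -> ell2 phi.
Proof. by move=> /ell2_leP h; apply/ell2E; apply: le_lt_trans h (ltry _). Qed.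

Lemma ell2_norm_sqr phi : ell2 phi -> ell2_le phi (ell2_norm phi ^+ 2).
Proof.
move=> /ell2E h; apply/ell2_leP; rewrite /ell2_norm sqr_sqrtr.
  by rewrite fineK// ge0_fin_numE// esum_abs2_ge0.
exact/fine_ge0/esum_abs2_ge0.
Qed.

Lemma ell2_norm_le phi s : ell2_le phi s -> ell2_norm phi <= Num.sqrt s.
Proof.
move=> h; rewrite /ell2_norm ler_wsqrtr//.
have /ell2_leP hs := h; have /ell2E hfin := ell2_le_ell2 h.
by rewrite -lee_fin fineK// ge0_fin_numE// esum_abs2_ge0.
Qed.

Lemma ell2_le_ge0 phi s : ell2_le phi s -> 0 <= s.
Proof. by move=> /(_ 0 0)%N; rewrite /window_sum big_ord0. Qed.

Lemma ell2_le_point phi s n : ell2_le phi s -> normc (phi n) <= Num.sqrt s.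
Proof.
move=> phis; have s0 := ell2_le_ge0 phis.
rewrite -(@ler_pXn2r _ 2)// ?nnegrE ?normc_ge0 ?sqrtr_ge0// sqr_sqrtr//.
have h := phis `|n|%N (`|n| + `|n|).+1%N; apply: le_trans h.
rewrite /window_sum.
have lt : (absz (n + `|n|%N%:Z)%R < (`|n| + `|n|).+1)%N by lia.
rewrite (bigD1 (Ordinal lt))//= (_ : _ - _ = n); last by lia.
by rewrite lerDl sumr_ge0// => i _; exact: sqr_ge0.
Qed.

Lemma ell2_le_eq0 phi : ell2_le phi 0 -> phi = fun=> 0.
Proof.
move=> h; apply: funext => n; apply: Normc.eq0_normc; apply: le_anti.
by rewrite normc_ge0 andbT; have := ell2_le_point n h; rewrite sqrtr0.
Qed.

Lemma sqr_convex (x y rho : R) : 0 < rho < 1 ->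
  (x + y) ^+ 2 <= rho^-1 * x ^+ 2 + (1 - rho)^-1 * y ^+ 2.
Proof.
move=> /andP[r0 r1]; rewrite -subr_ge0.
have r2 : 0 < 1 - rho by lra.
rewrite (_ : _ - _ = ((1 - rho) * x - rho * y) ^+ 2 / (rho * (1 - rho))).
  by rewrite divr_ge0 ?sqr_ge0// mulr_ge0// ltW.
by field; rewrite !gt_eqF.
Qed.

(** Used in place of the triangle inequality, by convexity of the square with weights [rho] and
    [1 - rho]. The free weight later serves as the contraction factor. *)
Lemma ell2_leD phi psi s t rho : 0 < rho < 1 -> ell2_le phi s -> ell2_le psi t ->
  ell2_le (fun n => phi n + psi n) (rho^-1 * s + (1 - rho)^-1 * t).
Proof.
move=> rho01 phis psit a m; have /andP[r0 r1] := rho01.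
apply: (@le_trans _ _ (rho^-1 * window_sum phi a m + (1 - rho)^-1 * window_sum psi a m)).
  rewrite /window_sum !mulr_sumr -big_split /=; apply: ler_sum => i _.
  apply: le_trans (sqr_convex _ _ rho01).
  by rewrite lerXn2r ?nnegrE ?addr_ge0 ?normc_ge0//; exact: le_normcD.
by apply: lerD; [apply: ler_wpM2l (phis a m)|apply: ler_wpM2l (psit a m)];
  rewrite invr_ge0 ?subr_ge0 ltW.
Qed.

Lemma ell2_leD2 phi psi s t : ell2_le phi s -> ell2_le psi t ->
  ell2_le (fun n => phi n + psi n) (2 * s + 2 * t).
Proof.
move=> phis psit; have := @ell2_leD phi psi s t 2^-1 _ phis psit.
rewrite invrK (_ : (1 - 2^-1)^-1 = 2 :> R); first by apply; lra.
by field.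
Qed.

Lemma ell2_leM (b : R) (f : int -> C) phi s : (forall n, normc (f n) <= b) ->
  ell2_le phi s -> ell2_le (fun n => f n * phi n) (b ^+ 2 * s).
Proof.
move=> fb phis a m.
apply: (@le_trans _ _ (b ^+ 2 * window_sum phi a m)); last by rewrite ler_wpM2l ?sqr_ge0.
rewrite /window_sum mulr_sumr; apply: ler_sum => i _.
rewrite Normc.normcM exprMn ler_wpM2r ?sqr_ge0//.
by rewrite lerXn2r ?nnegrE ?normc_ge0//; apply: le_trans (fb 0); exact: normc_ge0.
Qed.

Lemma ell2_leS phi s (k : int) : ell2_le phi s -> ell2_le (fun n => phi (n + k)) s.
Proof.
move=> phis a m.
apply: (@le_trans _ _ (window_sum phi (a + `|k|) (m + `|k| + `|k|))); last exact: phis.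
pose g i := normc (phi (i%:Z - (a + `|k|)%N%:Z)) ^+ 2.
rewrite [leRHS]/window_sum -(big_mkord xpredT g).
have -> : window_sum (fun n => phi (n + k)) a m =
    \sum_(absz (`|k|%N%:Z + k)%R <= i < absz (`|k|%N%:Z + k)%R + m) g i.
  rewrite -{1}[absz _]add0n big_addn addKn big_mkord.
  by apply: eq_bigr => i _; congr (normc (phi _) ^+ 2); lia.
by apply: sum_nat_sub => [i|]; [exact: sqr_ge0|lia].
Qed.

End EllTwoBound.

(** * The operators [H - z] and [1 - t (H - conj z)(H - z)] on the line *)

Section ShiftedOperator.
Variables (R : realType) (lambda : R) (w : full_shift).
Local Notation C := R[i].
Implicit Types (phi psi : int -> C) (z : C) (s t : R).

Definition shifted z phi : int -> C :=
  fun n => schroedinger lambda w phi n - z * phi n.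

Lemma shiftedE z phi n : shifted z phi n =
  phi (n + 1) + phi (n - 1) + (potential lambda w n)%:C%C * phi n - z * phi n.
Proof. by []. Qed.

Lemma shiftedD z c phi psi : shifted z (fun n => c * phi n + psi n) =
  fun n => c * shifted z phi n + shifted z psi n.
Proof. by apply: funext => n; rewrite !shiftedE; ring. Qed.

Lemma shiftedC z1 z2 phi : shifted z1 (shifted z2 phi) = shifted z2 (shifted z1 phi).
Proof. by apply: funext => n; rewrite !shiftedE; ring. Qed.

Definition shifted_bound z : R := 8 + 2 * (`|lambda| + normc z) ^+ 2.

Lemma shifted_bound_ge0 z : 0 <= shifted_bound z.
Proof. by rewrite addr_ge0// mulr_ge0// sqr_ge0. Qed.

Lemma ell2_le_shifted z phi s : ell2_le phi s ->
  ell2_le (shifted z phi) (shifted_bound z * s).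
Proof.
move=> phis.
have h1 := ell2_leD2 (ell2_leS 1 phis) (ell2_leS (-1) phis).
have h2 := @ell2_leM _ (`|lambda| + normc z)
  (fun n => (potential lambda w n)%:C%C - z) phi s.
have := ell2_leD2 h1 (h2 _ phis).
have -> : 2 * (2 * s + 2 * s) + 2 * ((`|lambda| + normc z) ^+ 2 * s) =
  shifted_bound z * s by rewrite /shifted_bound; ring.
rewrite (_ : shifted z phi = fun n => phi (n + 1) + phi (n + -1) +
  ((potential lambda w n)%:C%C - z) * phi n); last first.
  by apply: funext => n; rewrite !shiftedE; ring.
apply => n; apply: le_trans (ler_normcB _ _) _.
rewrite lerD2r normc_real /potential normrM.
by case: (w n); rewrite ?normr1 ?normr0 ?mulr1 ?mulr0.
Qed.

(** The homogeneous step of Richardson's iteration for the normal equation; as the potential is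
    real, [H - conj z] is the formal adjoint of [H - z]. *)
Definition richardson t z phi : int -> C :=
  fun n => phi n - t%:C%C * shifted (z^*)%C (shifted z phi) n.

Lemma richardsonB t z phi psi : richardson t z (fun n => phi n - psi n) =
  fun n => richardson t z phi n - richardson t z psi n.
Proof.
by apply: funext => n; rewrite /richardson /shifted /schroedinger; ring.
Qed.

End ShiftedOperator.

(** * Transfer of the contraction from long cycles to the line *)

Section Transplant.
Variables (R : realType) (lambda : R) (w : full_shift).
Local Notation C := R[i].
Implicit Types (phi : int -> C) (z : C) (s t : R).

Lemma ordD1 q (i : 'I_q.+2) : (i < q.+1)%N -> (i + 1 : 'I_q.+2) = i.+1 :> nat.
Proof. by move=> iq; rewrite -{1}(natr_Zp i) natr1 Zp_nat /= modn_small. Qed.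

Lemma ordB1 q (i : 'I_q.+2) : (0 < i)%N -> (i - 1 : 'I_q.+2) = i.-1 :> nat.
Proof.
move=> i0; have -> : i - 1 = i.-1%:R.
  by apply/eqP; rewrite subr_eq natr1 prednK// natr_Zp.
by rewrite Zp_nat /= modn_small//; have := ltn_ord i; lia.
Qed.

(** The operator only reads nearest neighbours, so one site is lost at each end of the range where
    the data agree; the wrap-around of the cycle is then not seen. *)
Lemma cyclic_shifted q W (psi : 'cV[C]_q.+2) phi z (a lo hi : nat) :
  (hi <= q.+1)%N ->
  (forall i : 'I_q.+2, (lo <= i <= hi)%N -> psi i 0 = phi (i%:Z - a%:Z)) ->
  forall i : 'I_q.+2, (lo < i < hi)%N -> w (i%:Z - a%:Z) = nth false W i ->
  ((cyclic_schroedinger lambda q W - z%:M) *m psi) i 0 =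
    shifted lambda w z phi (i%:Z - a%:Z).
Proof.
move=> hiq psiE i /andP[lo_i i_hi] wi.
rewrite mulmxBl mul_scalar_mx !mxE -/((cyclic_schroedinger _ _ _ *m _) _ _).
have -> : \sum_j cyclic_schroedinger lambda q W i j * psi j 0 =
  (cyclic_schroedinger lambda q W *m psi) i 0 by rewrite mxE.
rewrite mul_cyclic /cyclic_potential -wi !psiE ?ordD1 ?ordB1//; try lia.
rewrite /shifted /schroedinger /potential.
have -> : i.+1%:Z - a%:Z = i%:Z - a%:Z + 1 by lia.
by have -> : i.-1%:Z - a%:Z = i%:Z - a%:Z - 1 by lia.
Qed.

(* Trace 2 over [W] is the equation for the eigenvalues of the operator on a cycle
   with potential [W]. *)
Definition periodic_gap z (c : R) := forall K, exists W a,
  [/\ (K + 3 <= a)%N, (a + K + 3 < size W)%N,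
      forall n : int, (`|n| <= K + 3)%N -> w n = nth false W (absz (n + a%:Z)%R) &
      forall d : C, trace lambda d W = 2 -> c <= normc (d - z)].

(** Inside a window [richardson] only reads [phi] up to distance two, and there it agrees with the
    polynomial of [sqnorm_contraction] for a long cycle, applied to the restriction of [phi]. The
    gap keeps the eigenvalues of the cycle at distance [c] from [z], and the restriction has squared
    norm at most [s]. *)
Lemma ell2_le_richardson z c t phi s : 0 <= c -> 0 <= t ->
  t * (2 + `|lambda| + normc z) ^+ 2 <= 1 -> periodic_gap z c ->
  ell2_le phi s ->
  ell2_le (richardson lambda w t z phi) ((1 - t * c ^+ 2) ^+ 2 * s).
Proof.
move=> c0 t0 t1 gap phis a0 m0.
have [W [a [Ka aW wW gapW]]] := gap (a0 + m0)%N.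
have [q sizeW] : exists q, size W = q.+2 by exists (size W).-2; lia.
pose A := cyclic_schroedinger lambda q W.
pose psi : 'cV[C]_q.+2 := \col_i phi (i%:Z - a%:Z).
have Apsi (d : C) (v : 'cV[C]_q.+2) : A *m v = d *: v -> v != 0 ->
    c <= normc (d - z) /\ t * normc (d - z) ^+ 2 <= 1.
  move=> Av v0; split; first exact/gapW/(cyclic_eigenvalue_trace sizeW Av v0).
  apply: le_trans t1; rewrite ler_wpM2l// lerXn2r ?nnegrE ?normc_ge0//.
    by rewrite !addr_ge0 ?normc_ge0.
  apply: le_trans (ler_normcB _ _) _; rewrite lerD2r.
  exact: cyclic_eigenvector_bound Av v0.
have contr := sqnorm_contraction (cyclic_symmetric lambda q W)
  (cyclic_real lambda q W) t0 c0 Apsi psi.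
set K := (a0 + m0)%N in Ka aW wW.
have wi (i : nat) : (a - K.+1 <= i <= a + K.+1)%N ->
    w (i%:Z - a%:Z) = nth false W i.
  by move=> iI; rewrite wW; [congr nth|]; lia.
have psiE (i : 'I_q.+2) : (0 <= i <= q.+1)%N -> psi i 0 = phi (i%:Z - a%:Z).
  by rewrite mxE.
(* The first factor is identified on the sites of modulus at most [K + 1], so that the second one
   still is on those of modulus at most [K]. *)
have Apsi1 (i : 'I_q.+2) : (a - K.+1 <= i <= a + K.+1)%N ->
    ((A - z%:M) *m psi) i 0 = shifted lambda w z phi (i%:Z - a%:Z).
  move=> iI; have i0 : (0 < i < q.+1)%N by lia.
  exact: (@cyclic_shifted q W psi phi z a 0 q.+1 (leqnn _) psiE i i0 (wi i iI)).
have Apsi2 (i : 'I_q.+2) : (a - K.+1 < i < a + K.+1)%N ->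
    ((A - (z^*)%C%:M) *m ((A - z%:M) *m psi)) i 0 =
    shifted lambda w (z^*)%C (shifted lambda w z phi) (i%:Z - a%:Z).
  move=> iI; have iw : w (i%:Z - a%:Z) = nth false W i by apply: wi; lia.
  have Kq : (a + K.+1 <= q.+1)%N by lia.
  exact: (@cyclic_shifted q W _ _ _ a _ _ Kq Apsi1 i iI iw).
have colE (x y : 'cV[C]_q.+2) i : (x - t%:C%C *: y) i 0 = x i 0 - t%:C%C * y i 0.
  by rewrite !mxE.
pose g i := normc ((psi - t%:C%C *: ((A - (z^*)%C%:M) *m ((A - z%:M) *m psi)))
  (inord i) 0) ^+ 2.
apply: (@le_trans _ _ (\sum_(0 <= i < q.+2) g i)).
  rewrite (@window_sum_shift _ _ a); last by lia.
  apply: (@le_trans _ _ (\sum_(a - a0 <= i < a - a0 + m0) g i)).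
    apply: ler_sum_nat => i iI; rewrite /g colE Apsi2 ?inordK; try lia.
    by rewrite mxE inordK//; lia.
  by apply: sum_nat_sub => [i|]; [exact: sqr_ge0|lia].
rewrite big_mkord (eq_bigr (fun i : 'I_q.+2 => normc ((psi - t%:C%C *:
  ((A - (z^*)%C%:M) *m ((A - z%:M) *m psi))) i 0) ^+ 2)); last first.
  by move=> i _; rewrite /g inord_val.
apply: le_trans contr _; rewrite ler_wpM2l ?sqr_ge0//.
rewrite (_ : sqnorm psi = window_sum phi a q.+2)//.
by apply: eq_bigr => i _; rewrite mxE.
Qed.

End Transplant.

(** * Limits of complex sequences *)

Section ComplexLimits.
Variable R : realType.
Local Notation C := R[i].
Implicit Types (u v : nat -> C) (l : C).

Definition clim u l := normc (u k - l) @[k --> \oo] --> (0 : R).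

Lemma clim_le u l (e : nat -> R) : (forall k, normc (u k - l) <= e k) ->
  e k @[k --> \oo] --> (0 : R) -> clim u l.
Proof.
move=> ue; apply: (@squeeze_cvgr _ _ _ _ (fun=> 0) e); last exact: cvg_cst.
by apply: nearW => k; rewrite normc_ge0 ue.
Qed.

Lemma climD u v l l' : clim u l -> clim v l' -> clim (fun k => u k + v k) (l + l').
Proof.
move=> ul vl; apply: (@clim_le _ _ (fun k => normc (u k - l) + normc (v k - l'))).
  by move=> k; rewrite opprD addrACA; exact: le_normcD.
by rewrite -[X in _ --> X](addr0 0); exact: cvgD.
Qed.

Lemma climM c u l : clim u l -> clim (fun k => c * u k) (c * l).
Proof.
move=> ul; apply: (@clim_le _ _ (fun k => normc c * normc (u k - l))).
  by move=> k; rewrite -mulrBr Normc.normcM.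
by rewrite -[X in _ --> X](mulr0 (normc c)); apply: cvgM => //; exact: cvg_cst.
Qed.

Lemma clim_cst c : clim (fun=> c) c.
Proof. by rewrite /clim subrr Normc.normc0; exact: cvg_cst. Qed.

Lemma climB u v l l' : clim u l -> clim v l' -> clim (fun k => u k - v k) (l - l').
Proof.
move=> ul vl; have := climD ul (climM (-1) vl); rewrite mulN1r.
by under [X in clim X]funext do rewrite mulN1r.
Qed.

Lemma clim_shift u l : clim u l -> clim (fun k => u k.+1) l.
Proof. by move=> ul; rewrite /clim (cvg_shiftS (fun k => normc (u k - l))). Qed.

Lemma clim_unique u l l' : clim u l -> clim u l' -> l = l'.
Proof.
move=> ul ul'; have := climB ul ul'; rewrite /clim.
under eq_fun do rewrite subrr sub0r normcN.
move=> /(cvg_unique (@norm_hausdorff _ _) (cvg_cst _)) /Normc.eq0_normc.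
by move=> /eqP; rewrite subr_eq0 => /eqP.
Qed.

Lemma clim_normc u l : clim u l -> normc (u k) @[k --> \oo] --> normc l.
Proof.
move=> ul; apply/cvgrPdist_lt => e e0.
have /cvgr0_norm_lt/(_ e e0) := ul; apply: filterS => k.
rewrite ger0_norm ?normc_ge0// => h; apply: le_lt_trans h.
have h1 := le_normcB (u k) l; have := le_normcB l (u k).
by rewrite -(normcN (l - _)) opprB ler_norml => h2; lra.
Qed.

Lemma normc_Re_Im (x : C) :
  [/\ `|complex.Re x| <= normc x, `|complex.Im x| <= normc x &
      normc x <= `|complex.Re x| + `|complex.Im x|].
Proof.
case: x => a b /=; split.
- by rewrite -sqrtr_sqr ler_wsqrtr// lerDl sqr_ge0.
- by rewrite -sqrtr_sqr ler_wsqrtr// lerDr sqr_ge0.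
- rewrite -[leRHS]ger0_norm ?addr_ge0// -sqrtr_sqr ler_wsqrtr// sqrrD.
  by rewrite !real_normK ?num_real// addrAC lerDl mulrn_wge0// mulr_ge0.
Qed.

Lemma cvg_geometric_increments (x : nat -> R) (c rho : R) : 0 <= rho < 1 ->
  (forall k, `|x k.+1 - x k| <= c * rho ^+ k) -> cvgn x.
Proof.
move=> /andP[rho0 rho1] hx.
have -> : x = (fun k => x 0%N + series (telescope x) k).
  by apply: funext => k; exact: eq_sum_telescope.
apply: is_cvgD; first exact: is_cvg_cst.
apply: normed_cvg; apply: (@series_le_cvg _ _ (geometric c rho)) => [k|k|k|].
- exact: normr_ge0.
- by apply: le_trans (hx k); exact: normr_ge0.
- exact: hx.
- by apply: is_cvg_geometric_series; rewrite ger0_norm.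
Qed.

Lemma clim_geometric_increments u (c rho : R) : 0 <= rho < 1 ->
  (forall k, normc (u k.+1 - u k) <= c * rho ^+ k) -> exists l, clim u l.
Proof.
move=> rho01 hu.
have /cvg_ex[/= a ha] : cvgn (fun k => complex.Re (u k)).
  apply: cvg_geometric_increments rho01 _ => k; rewrite -raddfB.
  by apply: le_trans (hu k); have [] := normc_Re_Im (u k.+1 - u k).
have /cvg_ex[/= b hb] : cvgn (fun k => complex.Im (u k)).
  apply: cvg_geometric_increments rho01 _ => k; rewrite -raddfB.
  by apply: le_trans (hu k); have [] := normc_Re_Im (u k.+1 - u k).
exists (a +i* b)%C.
apply: (@clim_le _ _ (fun k => `|complex.Re (u k) - a| + `|complex.Im (u k) - b|)).
  by move=> k; have [_ _] := normc_Re_Im (u k - (a +i* b)%C); case: (u k).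
rewrite -[X in _ --> X](addr0 0); apply: cvgD.
  by rewrite -(@normr0 _ R); apply: cvg_norm; rewrite -(subrr a); apply: cvgB => //; exact: cvg_cst.
by rewrite -(@normr0 _ R); apply: cvg_norm; rewrite -(subrr b); apply: cvgB => //; exact: cvg_cst.
Qed.

(** A form of Fatou's lemma: only finite sums have to pass to the limit. *)
Lemma ell2_le_lim (psi_ : nat -> int -> C) psi s :
  (forall n, clim (psi_^~ n) (psi n)) -> (forall k, ell2_le (psi_ k) s) ->
  ell2_le psi s.
Proof.
move=> lim_psi bnd a m.
suff : window_sum (psi_ k) a m @[k --> \oo] --> window_sum psi a m.
  by move=> /cvgr_to_le; apply; apply: nearW => k; exact: bnd.
rewrite /window_sum; elim: m {bnd} => [|m IH].
  by under eq_fun do rewrite big_ord0; rewrite big_ord0; exact: cvg_cst.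
under eq_fun do rewrite big_ord_recr; rewrite big_ord_recr /=.
apply: cvgD => //; rewrite expr2; under eq_fun do rewrite expr2.
by apply: cvgM; exact: clim_normc.
Qed.

End ComplexLimits.

(** * From a contraction to the resolvent *)

Section Resolvent.
Variables (R : realType) (lambda : R) (w : full_shift) (z : R[i]).
Local Notation C := R[i].
Local Notation shifted := (shifted lambda w).
Variables (t rho : R).
Hypotheses (t_gt0 : 0 < t) (rho01 : 0 < rho < 1).
Hypothesis contracts : forall phi s, ell2_le phi s ->
  ell2_le (richardson lambda w t z phi) (rho ^+ 2 * s).
Implicit Types (phi psi : int -> C) (s : R).

Lemma shifted_clim y (psi_ : nat -> int -> C) psi :
  (forall n, clim (psi_^~ n) (psi n)) ->
  forall n, clim (fun k => shifted y (psi_ k) n) (shifted y psi n).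
Proof.
move=> lim_psi n; apply: climB; last exact: climM.
by apply: climD; [apply: climD|apply: climM].
Qed.

(** Partial sums of a Neumann series; a fixed point of the iterated map solves
    [(H - conj z)(H - z) psi = phi]. *)
Definition neumann phi k : int -> C :=
  iter k (fun psi n => richardson lambda w t z psi n + t%:C%C * phi n) (fun=> 0).

Lemma neumannS phi k n : neumann phi k.+1 n =
  richardson lambda w t z (neumann phi k) n + t%:C%C * phi n.
Proof. by []. Qed.

Lemma ell2_le_scale phi s : ell2_le phi s ->
  ell2_le (fun n => t%:C%C * phi n) (t ^+ 2 * s).
Proof.
apply: (@ell2_leM _ t (fun=> t%:C%C)) => _.
by rewrite normc_real ger0_norm// ltW.
Qed.

(** The constant [X] is the fixed point of the recursion for the bounds,
    [X = rho * X + t^2 s / (1 - rho)]. *)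
Lemma ell2_le_neumann phi s k : ell2_le phi s ->
  ell2_le (neumann phi k) (t ^+ 2 / (1 - rho) ^+ 2 * s).
Proof.
move=> phis; have s0 := ell2_le_ge0 phis; have /andP[r0 r1] := rho01.
have r2 : 1 - rho != 0 by rewrite subr_eq0 gt_eqF.
elim: k => [|k IH].
  move=> a m; rewrite /window_sum big1 => [|i _]; last first.
    by rewrite Normc.normc0 expr0n.
  by rewrite mulr_ge0// divr_ge0// sqr_ge0.
have := ell2_leD rho01 (contracts IH) (ell2_le_scale phis).
by congr ell2_le; field; rewrite r2 gt_eqF.
Qed.

Lemma ell2_le_neumannS phi s k : ell2_le phi s ->
  ell2_le (fun n => neumann phi k.+1 n - neumann phi k n)
    ((rho ^+ 2) ^+ k * (t ^+ 2 * s)).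
Proof.
move=> phis; elim: k => [|k IH].
  have := ell2_le_scale phis; rewrite expr0 mul1r.
  congr ell2_le; apply: funext => n; rewrite /neumann /= /richardson.
  by rewrite !shiftedE; ring.
have := contracts IH; rewrite richardsonB mulrA -exprS.
congr ell2_le; apply: funext => n.
by rewrite !neumannS; ring.
Qed.

Lemma shifted_solve phi s : ell2_le phi s -> exists2 psi,
  ell2_le psi (shifted_bound lambda (z^*)%C * (t ^+ 2 / (1 - rho) ^+ 2 * s)) &
  shifted z psi = phi.
Proof.
move=> phis; have s0 := ell2_le_ge0 phis; have /andP[r0 r1] := rho01.
have /choice[psi lim_psi] : forall n, exists l, clim ((neumann phi)^~ n) l.
  move=> n; apply: (@clim_geometric_increments _ _ (Num.sqrt (t ^+ 2 * s)) rho).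
    by rewrite ltW.
  move=> k; have := ell2_le_point n (ell2_le_neumannS k phis).
  rewrite exprAC sqrtrM ?sqr_ge0// sqrtr_sqr ger0_norm 1?mulrC//.
  by rewrite exprn_ge0// ltW.
have psis := ell2_le_lim lim_psi (fun k => ell2_le_neumann k phis).
(* The two factors commute, so applying [H - conj z] to the limit yields a preimage under
   [H - z]. *)
exists (shifted (z^*)%C psi); first exact: ell2_le_shifted.
rewrite shiftedC; apply: funext => n.
have h1 := clim_shift (lim_psi n).
have h2 : clim (fun k => neumann phi k.+1 n)
    (richardson lambda w t z psi n + t%:C%C * phi n).
  apply: climD; last exact: clim_cst.
  apply: climB => //; apply: climM; apply: shifted_clim => m.
  exact: shifted_clim.
have /eqP := clim_unique h1 h2.
rewrite /richardson -subr_eq0 [X in X == 0](_ : _ = t%:C%C *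
  (shifted (z^*)%C (shifted z psi) n - phi n)); last by ring.
rewrite mulf_eq0 subr_eq0 => /orP[/eqP/(congr1 (@complex.Re R)) /= t0|/eqP//].
by have := t_gt0; rewrite t0 ltxx.
Qed.

(** An element of the kernel is fixed by [richardson], which shrinks its norm by the factor
    [rho < 1]. *)
Lemma shifted_inj psi : ell2 psi -> shifted z psi = (fun=> 0) -> psi = fun=> 0.
Proof.
move=> psi2 zpsi; apply: ell2_le_eq0; have := ell2_norm_sqr psi2.
have contr : richardson lambda w t z psi = psi.
  apply: funext => n; rewrite /richardson zpsi shiftedE.
  by ring.
move=> /[dup] h /contracts; rewrite contr => /ell2_norm_le.
have N0 : 0 <= ell2_norm psi by exact: sqrtr_ge0.
have /andP[r0 r1] := rho01.
rewrite -exprMn sqrtr_sqr ger0_norm; last by rewrite mulr_ge0// ltW.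
move=> le.
have N1 : ell2_norm psi = 0 by nra.
by move: h; rewrite N1 expr0n.
Qed.

Lemma resolvent_set_of_contraction : resolvent_set (schroedinger lambda w) z.
Proof.
have sol phi : ell2 phi -> exists psi,
    [/\ ell2 psi, shifted z psi = phi & ell2_norm psi <=
      Num.sqrt (shifted_bound lambda (z^*)%C * (t ^+ 2 / (1 - rho) ^+ 2)) * ell2_norm phi].
  move=> /ell2_norm_sqr /shifted_solve[psi psis zpsi]; exists psi; split => //.
    exact: ell2_le_ell2 psis.
  apply: le_trans (ell2_norm_le psis) _.
  rewrite mulrA sqrtrM ?sqrtr_sqr; last first.
    by rewrite mulr_ge0 ?shifted_bound_ge0// divr_ge0// sqr_ge0.
  by rewrite ger0_norm// sqrtr_ge0.
have uniq psi1 psi2 : ell2 psi1 -> ell2 psi2 ->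
    shifted z psi1 = shifted z psi2 -> psi1 = psi2.
  move=> e1 e2 e12; have := @shifted_inj (fun n => -1 * psi2 n + psi1 n).
  have ed : ell2 (fun n => -1 * psi2 n + psi1 n).
    apply: ell2_le_ell2 (ell2_leD2 (@ell2_leM _ 1 (fun=> -1) psi2 _ _
      (ell2_norm_sqr e2)) (ell2_norm_sqr e1)) => _.
    by rewrite normcN Normc.normc1.
  move=> /(_ ed); rewrite shiftedD e12 => h.
  have {}h : (fun n => -1 * psi2 n + psi1 n) = fun=> 0.
    by apply: h; apply: funext => n; ring.
  apply: funext => n; have /eqP := congr1 (@^~ n) h.
  by rewrite mulN1r addrC subr_eq0 => /eqP.
pose solves phi := [set psi | [/\ ell2 psi, shifted z psi = phi &
  ell2_norm psi <= Num.sqrt (shifted_bound lambda (z^*)%C *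
    (t ^+ 2 / (1 - rho) ^+ 2)) * ell2_norm phi]].
(* The default, the zero sequence, is only taken outside [ell2]. On [ell2], uniqueness of solutions
   makes this choice linear and a two-sided inverse. *)
pose B phi := xget (fun=> 0) (solves phi).
have BP phi : ell2 phi -> solves phi (B phi) by move=> /sol; exact: xgetPex.
have lin (a : C) phi psi : ell2 phi -> ell2 psi -> ell2 (fun n => a * phi n + psi n).
  move=> e1 e2; apply: ell2_le_ell2 (ell2_leD2 (@ell2_leM _ (normc a) (fun=> a) phi _ _
      (ell2_norm_sqr e1)) (ell2_norm_sqr e2)) => _.
  exact: lexx.
exists B; last first.
  move=> phi e; split; last by have [_ + _] := BP _ e.
  have es : ell2 (shifted z phi).
    exact: ell2_le_ell2 (ell2_le_shifted _ _ _ (ell2_norm_sqr e)).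
  have [e1 e2 _] := BP _ es; exact: (uniq _ _ e1 e e2).
split.
- by move=> phi /BP[].
- move=> a phi psi e1 e2; have [b1 c1 _] := BP _ e1; have [b2 c2 _] := BP _ e2.
  have [b3 c3 _] := BP _ (lin a _ _ e1 e2).
  by apply: uniq => //; [exact: lin|rewrite shiftedD c1 c2 c3].
- exists (Num.sqrt (shifted_bound lambda (z^*)%C * (t ^+ 2 / (1 - rho) ^+ 2))).
  by move=> phi /BP[].
Qed.

End Resolvent.

(** * Energies with escaping traces lie in the resolvent set *)

Section Spectrum.
Variables (R : realType) (lambda : R).
Local Notation C := R[i].

Lemma resolvent_set_of_gap (w : full_shift) (z : C) (c : R) : 0 < c ->
  periodic_gap lambda w z c -> resolvent_set (schroedinger lambda w) z.
Proof.
move=> c0 gap.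
(* [M] bounds both [|d - z|] for the eigenvalues [d] of the cycles and [c]. With [t * M ^+ 2 = 1/2]
   the factor [1 - t * c ^+ 2] then lies in [[1/2, 1)]. *)
pose M := 2 + `|lambda| + normc z + c.
have M0 : 0 < M.
  have := normr_ge0 lambda; have := normc_ge0 z; rewrite /M; lra.
pose t := (2 * M ^+ 2)^-1.
have M2 : 0 < 2 * M ^+ 2 by rewrite mulr_gt0// exprn_gt0.
have t0 : 0 < t by rewrite invr_gt0.
have tM : t * M ^+ 2 = 2^-1.
  by rewrite /t; field; rewrite gt_eqF.
have tc : 0 < t * c ^+ 2 <= 2^-1.
  rewrite mulr_gt0 ?exprn_gt0//= -tM ler_wpM2l ?(ltW t0)//.
  rewrite lerXn2r ?nnegrE ?(ltW M0) ?(ltW c0)//.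
  by have := normr_ge0 lambda; have := normc_ge0 z; rewrite /M; lra.
apply: (@resolvent_set_of_contraction _ _ _ _ t (1 - t * c ^+ 2)) => //.
  by move: tc => ?; lra.
move=> phi s; apply: ell2_le_richardson => //; try exact: ltW.
apply: (@le_trans _ _ (t * M ^+ 2)); last by rewrite tM; lra.
have M1 : 0 <= 2 + `|lambda| + normc z.
  by have := normr_ge0 lambda; have := normc_ge0 z; lra.
by rewrite ler_wpM2l ?(ltW t0)// lerXn2r ?nnegrE ?(ltW M0)// /M; lra.
Qed.

Variable alpha : R.
Hypothesis halpha : 0 < alpha < 1.
Hypothesis hirr : irrational alpha.

(** The words [ev] are prefixes of the coding of 0, and late ones contain a prescribed window of
    [w]. Escape extends to a disc around [E] and to all later steps, so the traces over these words
    exceed 2 in modulus on the disc. *)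
Lemma periodic_gap_of_escaping (w : full_shift) E n : sturmian_hull alpha w ->
  escaping_at lambda alpha E n -> exists2 c, 0 < c & periodic_gap lambda w E c.
Proof.
move=> /sturmian_hullP hull /escaping_at_open[c c0 esc]; exists c => // K.
have [m Km agree] := hull (K + 3)%N (K + 3)%N.
have [N hN] := size_euclid_infty halpha hirr (m + K + 10)%N.
have [_ sv] := hN (maxn n N) (leq_maxr _ _).
(* The centre is [m.+1] because [ev] codes the orbit of [0], the Sturmian word that of [f 0]. *)
exists (ev alpha (maxn n N)), m.+1; split; first by lia.
- by lia.
- move=> j jK.
  have ind := euclid_exchange halpha hirr (maxn n N).
  have /andP[a0 _] := exchange_a ind.
  have v0 : (0 : R) <= 0 < ea alpha (maxn n N) by rewrite lexx.
  have [codeE _] := exchange_v ind v0.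
  rewrite -codeE.
  rewrite nth_coding; last by lia.
  have -> : w j = sturmian_word alpha (j + m%:Z).
    have [j0|j0] := lerP 0 j.
      have e : j = `|j|%N%:Z by lia.
      by rewrite e; exact: (agree _ jK).1.
    have e : j = - `|j|%N%:Z by lia.
    by rewrite e; exact: (agree _ jK).2.
  have -> : j + m%:Z = (absz (j + m%:Z)%R)%:Z by lia.
  rewrite sturmian_wordE// -iterSr; congr (letter (iter _ (rotation alpha) 0)); lia.
- move=> d tr2; rewrite leNgt; apply/negP => /esc.
  move=> /(escaping_at_le (leq_maxl n N))[_ + _ _].
  by rewrite tr2 -(@rmorph_nat _ _ (real_complex R) 2) normc_real normr_nat ltxx.
Qed.

Lemma not_escaping_of_spectrum (w : full_shift) E n : sturmian_hull alpha w ->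
  spectrum (schroedinger lambda w) E -> ~ escaping_at lambda alpha E n.
Proof.
move=> wH spE /(periodic_gap_of_escaping wH)[c c0 gap].
exact/spE/(resolvent_set_of_gap c0 gap).
Qed.

End Spectrum.

(** * Positive measure of the stability set *)

Theorem theorem3 (R : realType) (alpha : R)
    (halpha : 0 < alpha < 1) (hirr : irrational alpha)
    (mu : probability borel_full_shift R) (hmu : invariant_on_hull alpha mu)
    (lambda : R) :
  exists Omega0 : set borel_full_shift,
    [/\ measurable Omega0,
        Omega0 `<=` stability_set alpha lambda &
        (0 < mu Omega0)%E].
Proof.
have [k hk mu0] := mu_limsup_squares halpha hirr hmu.
pose F n : set borel_full_shift :=
  sturmian_hull alpha `&` squares_of (kept alpha (k n)).
exists (lim_sup_set F); split => //.
  apply: bigcapT_measurable => n; apply: bigcup_measurable => i _.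
  by apply: measurableI; [exact: measurable_hull|exact: measurable_squares].
move=> w wF; have [_ _ [wH _]] := wF 0%N Logic.I.
split=> // E spE; exists false.
apply: (@no_ell2_solution_of_squares _ _ _ _ (6 + `|lambda|)) => N.
have [N0 hN0] := size_kept_infty halpha hirr N.
have [i /= N0i [_ [sq [r wr]]]] := wF N0 Logic.I.
have N0k := leq_trans N0i (hk i).
exists (size (kept alpha (k i))); split => //; first by have [] := hN0 _ N0k.
(* The initial block is only a cyclic conjugate of the kept word, but has the same trace. *)
rewrite -(trace_rot lambda E r) wr.
by apply: trace_kept_le; exact: (not_escaping_of_spectrum halpha hirr wH spE).
Qed.
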